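(* Let $(L_t)_{t\in\mathbb{R}}$ be a two-sided subordinator with non-zero Lévy measure $\nu$ satisfying $\int_1^\infty x\,\nu(\mathrm{d}x)<\infty$, and let $\phi$ be a signed measure on $[0,\infty)$ with $\int_0^\infty t^2\,|\phi|(\mathrm{d}t)<\infty$. Let $h_\phi(z)=z-\int_{[0,\infty)}e^{-zt}\,\phi(\mathrm{d}t)$ for $z\in\mathbb{C}_+$, and assume that $h_\phi(z)\neq 0$ for all $z\in\mathbb{C}_+$. Let $g_\phi:[0,\infty)\to\mathbb{R}$ be characterized by $\int_0^\infty e^{-ity}g_\phi(t)\,\mathrm{d}t=1/h_\phi(iy)$ for $y\in\mathbb{R}$, and let $X_t=\int_{-\infty}^t g_\phi(t-u)\,\mathrm{d}L_u$, $t\in\mathbb{R}$. Suppose further that $\phi$ is a non-negative measure when restricted to $(0,\infty)$, that is, $\phi(B\cap(0,\infty))\ge 0$ for all measurable sets $B$. Then all of the following statements hold: (i) $X_t\ge 0$ almost surely for some $t\in\mathbb{R}$. (ii) $X_t\ge 0$ almost surely for all $t\in\mathbb{R}$. (iii) $g_\phi$ is non-negative almost everywhere. (iv) $1/h_\phi$ is completely monotone on $[0,\infty)$, that is, $(-1)^n\frac{\mathrm{d}^n}{\mathrm{d}x^n}\frac{1}{h_\phi(x)}\ge 0$ for all $x>0$ and $n\in\mathbb{N}_0$.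
   Context: $\mathbb{C}_+=\{z\in\mathbb{C}:\operatorname{Re}(z)\ge 0\}$. A one-sided subordinator is a real-valued process $(L_t)_{t\ge0}$ with $L_0=0$, càdlàg sample paths, and stationary, independent, non-negative increments; its Lévy measure $\nu$ is a measure on $(0,\infty)$ with $\int_0^\infty(1\wedge x)\,\nu(\mathrm{d}x)<\infty$. A two-sided subordinator is $L_t=L^1_t\mathbf{1}_{[0,\infty)}(t)-L^2_{(-t)-}\mathbf{1}_{(-\infty,0)}(t)$, $t\in\mathbb{R}$, where $L^1,L^2$ are independent one-sided subordinators with the same law (with Lévy measure $\nu$). The condition $\int_1^\infty x\,\nu(\mathrm{d}x)<\infty$ is equivalent to $\mathbb{E}[L_1]<\infty$. A signed measure on $[0,\infty)$ is a set function $\mu=\mu_+-\mu_-$ with $\mu_+,\mu_-$ mutually singular finite Borel measures on $[0,\infty)$; $|\mu|=\mu_++\mu_-$. When $h_\phi$ has no zeroes on $\mathbb{C}_+$, it is known that $g_\phi$ exists (as an integrable function, unique up to Lebesgue null sets), that the integral defining $X_t$ is well-defined, and that $(X_t)_{t\in\mathbb{R}}$ is the unique stationary process with finite first moments such that, for each fixed $s<t$, almost surely $X_t-X_s=\int_s^t\int_{[0,\infty)}X_{u-v}\,\phi(\mathrm{d}v)\,\mathrm{d}u+L_t-L_s$. The process is defined for each fixed $t$ up to a set of probability zero; (ii) means that for each $t\in\mathbb{R}$, $X_t\ge0$ with probability one. *)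

(* Defs.v *)
From HB Require Import structures.
From mathcomp Require Import all_boot all_order all_algebra.
From mathcomp Require Import all_classical all_reals all_analysis.
From mathcomp Require Import complex.

Set Implicit Arguments.
Unset Strict Implicit.
Unset Printing Implicit Defensive.

Import Order.TTheory GRing.Theory Num.Theory.
Import numFieldNormedType.Exports.

Local Open Scope classical_set_scope.
Local Open Scope ring_scope.
Local Open Scope complex_scope.

Section ComplexIntegrals.
Context {R : realType}.

Definition cexp (z : R[i]) : R[i] :=
  (expR (complex.Re z))%:C * (cos (complex.Im z) +i* sin (complex.Im z)).

Definition cintegral (mu : {measure set (measurableTypeR R) -> \bar R})
    (D : set R) (f : R -> R[i]) : R[i] :=
  (\int[mu]_(t in D) complex.Re (f t)) +i* (\int[mu]_(t in D) complex.Im (f t)).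

End ComplexIntegrals.

(* A signed measure on [0, +oo[, given by its Jordan decomposition; both parts
   are measures on the Borel sets of R that do not charge ]-oo, 0[. *)
Record signed_measure (R : realType) := SignedMeasure {
  sm_pos : {finite_measure set (measurableTypeR R) -> \bar R} ;
  sm_neg : {finite_measure set (measurableTypeR R) -> \bar R} ;
  sm_pos_supp : sm_pos `]-oo, 0[%classic = 0%E ;
  sm_neg_supp : sm_neg `]-oo, 0[%classic = 0%E ;
  sm_singular : exists A : set (measurableTypeR R),
    [/\ measurable A, sm_pos (~` A) = 0%E & sm_neg A = 0%E] }.

Section SignedMeasures.
Context {R : realType} (phi : signed_measure R).

Definition sm_val (B : set (measurableTypeR R)) : \bar R :=
  (sm_pos phi B - sm_neg phi B)%E.

Definition sm_var : {measure set (measurableTypeR R) -> \bar R} :=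
  measure_add (sm_pos phi) (sm_neg phi).

Definition sm_cintegral (f : R -> R[i]) : R[i] :=
  cintegral (sm_pos phi) `[0, +oo[ f - cintegral (sm_neg phi) `[0, +oo[ f.

Definition h_fun (z : R[i]) : R[i] :=
  z - sm_cintegral (fun t => cexp (- z * t%:C)).

(* Taking [complex.Re] of [1 / h_fun x%:C] therefore loses nothing. *)
Lemma h_fun_real (x : R) : complex.Im (h_fun x%:C) = 0.
Proof.
have Im0 (mu : {measure set (measurableTypeR R) -> \bar R}) :
    \int[mu]_(t in `[0, +oo[) complex.Im (cexp (- x%:C * t%:C)) = 0.
  rewrite /Rintegral integral0_eq// => t _.
  by rewrite /cexp /= !(mulr0, mul0r, oppr0, addr0, sin0).
by rewrite /h_fun /sm_cintegral /cintegral /= !Im0 !subr0.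
Qed.

(* [g] is (a Borel version of) the function g_phi. *)
Definition is_g_fun (g : R -> R) : Prop :=
  (@lebesgue_measure R).-integrable `[0, +oo[ (EFin \o g) /\
  forall y : R,
    cintegral lebesgue_measure `[0, +oo[
      (fun t => cexp (0 -i* (t * y)) * (g t)%:C) = 1 / h_fun (0 +i* y).

End SignedMeasures.

(* The derivatives are required to exist, since [derive1n] is total. *)
Definition completely_monotone (R : realType) (f : R -> R) : Prop :=
  forall (n : nat) (x : R), 0 < x ->
    derivable (derive1n n f) x 1 /\ 0 <= (-1) ^+ n * derive1n n f x.

Section Processes.
Context {R : realType} {d : measure_display} {T : measurableType d}.
Variable P : probability T R.

Definition mutually_independent (n : nat) (X : nat -> T -> R) : Prop :=
  forall B : nat -> set R, (forall k, measurable (B k)) ->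
    P (\bigcap_(k < n) (X k @^-1` B k)) = (\prod_(k < n) P (X k @^-1` B k))%E.

(* Processes on the half-line are indexed by R, but only their values at
   nonnegative times are constrained or used. *)
Definition independent_processes (L1 L2 : R -> T -> R) : Prop :=
  forall (n : nat) (s t : nat -> R) (A B : nat -> set R),
    (forall k, 0 <= s k) -> (forall k, 0 <= t k) ->
    (forall k, measurable (A k)) -> (forall k, measurable (B k)) ->
    let E := \bigcap_(k < n) (L1 (s k) @^-1` A k) in
    let F := \bigcap_(k < n) (L2 (t k) @^-1` B k) in
    P (E `&` F) = (P E * P F)%E.

Definition same_law (L1 L2 : R -> T -> R) : Prop :=
  forall (n : nat) (t : nat -> R) (B : nat -> set R),
    (forall k, 0 <= t k) -> (forall k, measurable (B k)) ->
    P (\bigcap_(k < n) (L1 (t k) @^-1` B k)) =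
    P (\bigcap_(k < n) (L2 (t k) @^-1` B k)).

Definition cadlag (F : R -> R) : Prop :=
  (forall t, 0 <= t -> F s @[s --> t^'+] --> F t) /\
  (forall t, 0 < t -> cvg (F s @[s --> t^'-])).

(* Levy-Khintchine formula for subordinators, in Laplace transform form,
   with drift [b]: E[exp(- u L_t)] =
   exp(- t (b u + \int_(0, +oo) (1 - exp(- u x)) nu(dx))). *)
Definition has_levy_measure (nu : {measure set (measurableTypeR R) -> \bar R})
    (L : R -> T -> R) : Prop :=
  [/\ nu `]-oo, 0]%classic = 0%E,
      (\int[nu]_(x in `]0%R, +oo[) (Num.min 1 x)%:E < +oo)%E &
      exists2 b : R, 0 <= b & forall t u : R, 0 <= t -> 0 <= u ->
        ('E_P[fun w => expR (- u * L t w)%R])%E =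
        (expR (- t * (b * u +
           \int[nu]_(x in `]0, +oo[) (1 - expR (- u * x)))))%:E].

Definition subordinator (nu : {measure set (measurableTypeR R) -> \bar R})
    (L : R -> T -> R) : Prop :=
  [/\ {ae P, forall w, L 0 w = 0},
      {ae P, forall w, cadlag (L ^~ w)},
      (forall s t, 0 <= s -> s <= t -> {ae P, forall w, 0 <= L t w - L s w}),
      (forall (s t : R) (B : set R), 0 <= s -> 0 <= t -> measurable B ->
         P ((L (s + t) \- L s) @^-1` B) = P ((L t \- L 0) @^-1` B)) &
      (forall (n : nat) (t : nat -> R), 0 <= t 0%N ->
         {homo t : i j / (i <= j)%N >-> i <= j} ->
         mutually_independent n (fun k => L (t k.+1) \- L (t k)))] /\
  has_levy_measure nu L.

Definition two_sided_subordinator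
    (nu : {measure set (measurableTypeR R) -> \bar R})
    (L : R -> T -> R) : Prop :=
  exists L1 L2 : R -> {RV P >-> R},
    [/\ subordinator nu (fun t => L1 t), subordinator nu (fun t => L2 t),
        independent_processes (fun t => L1 t) (fun t => L2 t),
        same_law (fun t => L1 t) (fun t => L2 t) &
        forall t w, L t w = if 0 <= t then L1 t w
                            else - lim (L2 s w @[s --> (- t)^'-])].

End Processes.

Section MovingAverage.
Context {R : realType}.

Definition to_cumulative (F : R -> R) (ndF : nondecreasing F)
    (rcF : right_continuous F) : cumulative R R :=
  HB.pack_for (cumulative R R) F (isCumulative.Build R _ R F ndF rcF).

(* The Lebesgue-Stieltjes measure dF of a path; the junk value 0 is taken on a
   null set only when [F] is a path of a two-sided subordinator. *)
Definition stieltjes (F : R -> R) : {measure set (measurableTypeR R) -> \bar R} :=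
  match pselect (nondecreasing F /\ right_continuous F) with
  | left H => lebesgue_stieltjes_measure (to_cumulative H.1 H.2)
  | right _ => mzero
  end.

(* The paths of L are nondecreasing, so the integral with respect to L is the
   pathwise Lebesgue-Stieltjes integral. *)
Definition moving_average {d : measure_display} {T : measurableType d}
    (g : R -> R) (L : R -> T -> R) (t : R) (w : T) : R :=
  \int[stieltjes (L ^~ w)]_(u in `]-oo, t]) g (t - u).

End MovingAverage.

(* Main.v *)
Require Import Defs.
From mathcomp Require Import all_boot all_order all_algebra.
From mathcomp Require Import all_classical all_reals all_analysis.
From mathcomp Require Import complex.
From mathcomp Require Import measurable_realfun.
From mathcomp Require Import ring lra.

(** Let n be the mass of the negative part of phi and m the mass of the positive
part. As phi is nonnegative on (0, oo), its negative part is n times the Dirac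
mass at 0, so that h(z) = z + n - F(z), where F is the Laplace transform of the
positive part. Since h is continuous on [0, oo), has no zero there and tends to
infinity, it is positive there ([shifted_laplace_gt0]); at 0 this says m < n.

Complete monotonicity of 1/h. The derivative h'(x) is 1 plus the Laplace
transform of t times the positive part, hence completely monotone. The equation
(1/h)' = - h' (1/h)^2 then gives the signs of the derivatives of 1/h one after
the other ([alternating_riccati]).

Nonnegativity of g. Let e(t) = exp(-nt) on [0, oo), extend g by 0, and let * be
convolution. Dividing h(iy) g^(y) = 1 by n + iy yields the Fourier transform of
the renewal equation g = e + (g * pos) * e, which therefore holds almost
everywhere ([renewal_equation], [fourier_uniqueness]). Taking L1 norms,
|g| <= 1/n + (m/n) |g|, hence |g| <= 1/(n - m) = 1/h(0), which is the integral
of g. An integrable function whose norm is at most its integral is nonnegative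
almost everywhere ([g_ge0]).

Nonnegativity of X_t. The function g may be negative on a Lebesgue null set, so
it remains to see that almost surely dL does not charge a given null set N
([stieltjes_null_set]). The Laplace transform of L_t and the moment hypothesis
on nu give E(L_t) <= C t, and by stationarity the mean of dL(]a, b]) is at most
C (b - a). Covering N by intervals of total length eps, its dL-mass is
dominated by a random variable of mean at most a constant times eps.

Fourier uniqueness on L1 is proved by inversion: a function with vanishing
cosine and sine transforms has vanishing Poisson integrals, because the Poisson
kernel is an average of cosines; integrating these over an interval and letting
the width of the kernel tend to 0 shows that the function has integral 0 over
each interval. *)

Set Implicit Arguments.
Unset Strict Implicit.
Unset Printing Implicit Defensive.

Import Order.TTheory GRing.Theory Num.Theory.
Import numFieldNormedType.Exports.

Local Open Scope classical_set_scope.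
Local Open Scope ring_scope.

(** * Measurability and integrability *)

Section Preliminaries.
Context {R : realType}.

Lemma derivable_continuousR (f : R -> R) :
  (forall x : R, derivable f x 1) -> continuous f.
Proof.
by move=> df x; apply: differentiable_continuous; apply/derivable1_diffP.
Qed.

Lemma derivable_measurableR (f : R -> R) :
  (forall x : R, derivable f x 1) -> measurable_fun setT f.
Proof.
by move=> df; apply: continuous_measurable_fun; exact: derivable_continuousR.
Qed.

Lemma normr_cos_le1 (x : R) : `|cos x| <= 1.
Proof. by rewrite ler_norml cos_geN1 cos_le1. Qed.

Lemma normr_sin_le1 (x : R) : `|sin x| <= 1.
Proof. by rewrite ler_norml sin_geN1 sin_le1. Qed.

Lemma integrable_boundedM d (X : measurableType d)
    (m : {measure set X -> \bar R}) (D : set X) (f psi : X -> R) (M : R) :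
  measurable D -> m.-integrable D (EFin \o f) -> measurable_fun D psi ->
  (forall x, `|psi x| <= M) ->
  m.-integrable D (EFin \o (fun x => f x * psi x)).
Proof.
move=> mD fi mpsi psiM; apply: (le_integrable mD _ _ (integrableZl mD M fi)).
  apply/measurable_EFinP; apply: measurable_funM => //.
  by apply/measurable_EFinP; exact: (measurable_int m).
move=> x _ /=; rewrite lee_fin !normrM mulrC ler_wpM2r//.
exact: le_trans (psiM x) (ler_norm _).
Qed.

Lemma integrable_bounded_mul d (X : measurableType d)
    (m : {measure set X -> \bar R}) (D : set X) (f psi : X -> R) :
  measurable D -> m.-integrable D (EFin \o f) -> measurable_fun D psi ->
  (forall x, `|psi x| <= 1) ->
  m.-integrable D (EFin \o (fun x => f x * psi x)).
Proof. exact: integrable_boundedM. Qed.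

End Preliminaries.

(** * Laplace transforms of cosine and sine *)

Section CosLaplace.
Context {R : realType}.
Local Notation mu := (@lebesgue_measure R).

Lemma cvg_expRNM (l : R) : 0 < l -> expR (- (l * x)) @[x --> +oo] --> (0 : R).
Proof.
move=> l0.
apply: (@cvg_comp _ _ _ (fun x => l * x) (fun z => expR (- z)) _ (pinfty_nbhs R)).
  exact: gt0_cvgMry.
exact: cvgr_expR.
Qed.

Lemma integral_expRN (l : R) : 0 < l ->
  (\int[mu]_(x in `[0%R, +oo[) (expR (- (l * x)))%:E)%E = l^-1%:E.
Proof.
move=> l0.
have cf : continuous (fun x : R => expR (- (l * x))).
  by apply: derivable_continuousR => x; exact: ex_derive.
rewrite (@ge0_continuous_FTC2y _ _ (fun x => - l^-1 * expR (- (l * x))) 0 0).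
- by rewrite mulr0 oppr0 expR0 sub0e mulr1 EFinN oppeK.
- by move=> x _; rewrite expR_ge0.
- exact: continuous_subspaceT.
- rewrite -[X in _ --> X](mulr0 (- l^-1)); apply: cvgMr; exact: cvg_expRNM.
- by move=> x _; exact: ex_derive.
- apply: cvg_at_right_filter; apply: cvgMr; exact: cf.
- move=> x _; rewrite derive1E; apply: derive_val.
  apply: is_derive_eq; rewrite /GRing.scale /=.
  by field; rewrite gt_eqF.
Qed.


(** The summand 1 makes the integrand nonnegative, so that monotone convergence
extends the fundamental theorem of calculus from bounded intervals to the
half-line; it is subtracted again in [Rintegral_expRNtrig]. *)
Lemma integral_expRN1trig (l s p q : R) : 0 < l -> `|p| + `|q| <= 1 ->
  (\int[mu]_(x in `[0%R, +oo[)
     (expR (- (l * x)) * (1 + (p * cos (s * x) + q * sin (s * x))))%:E)%E =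
  (l^-1 + (p * l + q * s) / (l ^+ 2 + s ^+ 2))%:E.
Proof.
move=> l0 pq1.
have d0 : l ^+ 2 + s ^+ 2 != 0.
  by rewrite gt_eqF// ltr_pwDl ?sqr_ge0// exprn_gt0.
have trig_le (a b t : R) : `|a * cos t + b * sin t| <= `|a| + `|b|.
  rewrite (le_trans (ler_normD _ _))// !normrM lerD// ler_piMr//.
    by rewrite ler_norml cos_geN1 cos_le1.
  by rewrite ler_norml sin_geN1 sin_le1.
pose A := (- p * l - q * s) / (l ^+ 2 + s ^+ 2).
pose B := (p * s - q * l) / (l ^+ 2 + s ^+ 2).
pose F (x : R) := expR (- (l * x)) *
  (- l^-1 + (A * cos (s * x) + B * sin (s * x))).
have dF (x : R) : is_derive x 1 F
    (expR (- (l * x)) * (1 + (p * cos (s * x) + q * sin (s * x)))).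
  rewrite /F; apply: is_derive_eq.
  rewrite /GRing.scale /= /A /B.
  by field; rewrite d0 gt_eqF.
have cF : continuous F.
  by apply: derivable_continuousR => x; exact: ex_derive.
have cf : continuous (fun x : R =>
    expR (- (l * x)) * (1 + (p * cos (s * x) + q * sin (s * x)))).
  by apply: derivable_continuousR => x; exact: ex_derive.
rewrite (@ge0_continuous_FTC2y _ _ F 0 0).
- rewrite sub0e -EFinN; congr (_%:E); rewrite /F /A /B !mulr0 oppr0 expR0 sin0 cos0.
  by field; rewrite d0 gt_eqF.
- move=> x _; rewrite mulr_ge0 ?expR_ge0//.
  have := le_trans (trig_le p q (s * x)) pq1.
  by rewrite ler_norml => /andP[]; lra.
- exact: continuous_subspaceT.
- pose K := l^-1 + (`|A| + `|B|).
  have FK x : `|F x| <= expR (- (l * x)) * K.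
    rewrite normrM ger0_norm ?expR_ge0// ler_wpM2l ?expR_ge0//.
    rewrite (le_trans (ler_normD _ _))// lerD//.
    by rewrite normrN ger0_norm// invr_ge0 ltW.
  have K0 : expR (- (l * x)) * K @[x --> +oo] --> (0 : R).
    by rewrite -(mul0r K); apply: cvgMl; exact: cvg_expRNM.
  apply: (@squeeze_cvgr _ _ _ _ (fun x => - (expR (- (l * x)) * K))
    (fun x => expR (- (l * x)) * K)).
  + by near=> x; rewrite -ler_norml.
  + by rewrite -oppr0; exact: cvgN.
  + exact: K0.
- by move=> x _; exact: ex_derive.
- apply: cvg_at_right_filter; exact: cF.
- by move=> x _; rewrite derive1E; apply: derive_val.
Unshelve. all: by end_near. Qed.

Lemma integrable_expRN (l : R) : 0 < l ->
  mu.-integrable `[0%R, +oo[ (EFin \o (fun x => expR (- (l * x)))).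
Proof.
move=> l0; apply/integrableP; split.
  apply/measurable_EFinP; apply: measurable_funTS.
  by apply: measurableT_comp => //; exact: measurable_funN.
under eq_integral do rewrite /= ger0_norm ?expR_ge0//.
by rewrite integral_expRN// ltry.
Qed.

Lemma Rintegral_expRNtrig (l s p q : R) : 0 < l -> `|p| + `|q| <= 1 ->
  \int[mu]_(x in `[0%R, +oo[)
     (expR (- (l * x)) * (p * cos (s * x) + q * sin (s * x))) =
  (p * l + q * s) / (l ^+ 2 + s ^+ 2).
Proof.
move=> l0 pq1.
have trig_le1 (t : R) : `|p * cos t + q * sin t| <= 1.
  apply: le_trans pq1; rewrite (le_trans (ler_normD _ _))// !normrM lerD//.
    by rewrite ler_piMr// normr_cos_le1.
  by rewrite ler_piMr// normr_sin_le1.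
have i1 := integrable_expRN l0.
have i2 : mu.-integrable `[0%R, +oo[ (EFin \o (fun x =>
    expR (- (l * x)) * (p * cos (s * x) + q * sin (s * x)))).
  apply: integrable_bounded_mul => //.
  apply: measurable_funTS; apply: derivable_measurableR => x; exact: ex_derive.
have := integral_expRN1trig s l0 pq1.
move=> /(congr1 fine)/=.
rewrite (_ : fine _ = \int[mu]_(x in `[0%R, +oo[)
  (expR (- (l * x)) + expR (- (l * x)) * (p * cos (s * x) + q * sin (s * x)))); last first.
  by apply: eq_Rintegral => x _; rewrite mulrDr mulr1.
rewrite RintegralD// => E.
apply: (addrI (l^-1)); rewrite -E; congr (_ + _).
by rewrite /Rintegral integral_expRN.
Qed.

Lemma Rintegral_expRNcos (l s : R) : 0 < l ->
  \int[mu]_(x in `[0%R, +oo[) (expR (- (l * x)) * cos (s * x)) =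
  l / (l ^+ 2 + s ^+ 2).
Proof.
move=> l0; have := @Rintegral_expRNtrig l s 1 0 l0.
rewrite normr1 normr0 addr0 mul0r addr0 mul1r => <-//.
by apply: eq_Rintegral => x _; rewrite mul1r mul0r addr0.
Qed.

Lemma Rintegral_expRNsin (l s : R) : 0 < l ->
  \int[mu]_(x in `[0%R, +oo[) (expR (- (l * x)) * sin (s * x)) =
  s / (l ^+ 2 + s ^+ 2).
Proof.
move=> l0; have := @Rintegral_expRNtrig l s 0 1 l0.
rewrite normr1 normr0 add0r mul0r add0r mul1r => <-//.
by apply: eq_Rintegral => x _; rewrite mul1r mul0r add0r.
Qed.

End CosLaplace.

(** * Fubini's theorem for real-valued integrals *)

Section RealFubini.
Context {R : realType}.

Lemma integrable_fine d (X : measurableType d) (m : {measure set X -> \bar R})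
    (h : X -> \bar R) : m.-integrable setT h ->
  m.-integrable setT (EFin \o (fine \o h)) /\
  (\int[m]_x h x)%E = (\int[m]_x (fine (h x))%:E)%E.
Proof.
move=> hi; have mh := measurable_int m hi.
have mf : measurable_fun setT (EFin \o (fine \o h)).
  by apply/measurable_EFinP; exact: measurableT_comp.
have E : ae_eq m setT h (EFin \o (fine \o h)).
  have := integrable_ae measurableT hi.
  by apply: filterS => x /(_ I) hx _ /=; rewrite fineK.
split; last exact: ae_eq_integral.
apply: (le_integrable measurableT mf _ hi) => x _ /=.
by case: (h x) => [r| |] //=; rewrite normr0 leey.
Qed.

(** The inner integrals may be infinite on a null set, where [Rintegral] has the
value 0; [integrable_fine] shows that this does not affect the outer ones. *)
Lemma RFubini d1 d2 (T1 : measurableType d1) (T2 : measurableType d2)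
    (m1 : {sigma_finite_measure set T1 -> \bar R})
    (m2 : {sigma_finite_measure set T2 -> \bar R}) (F : T1 * T2 -> R) :
  (m1 \x m2)%E.-integrable setT (EFin \o F) ->
  \int[m1]_x \int[m2]_y F (x, y) = \int[m2]_y \int[m1]_x F (x, y).
Proof.
move=> Fi; rewrite /Rintegral.
have [_ E1] := integrable_fine (integrable_fubini_F Fi).
have Fi' : (m2 \x m1)%E.-integrable setT (EFin \o (fun z => F (z.2, z.1))).
  have mF : measurable_fun setT (EFin \o F) by exact: (measurable_int _ Fi).
  apply/integrable12ltyP; last by have /(integrable21ltyP _ _ mF) := Fi.
  exact: (measurableT_comp mF (@measurable_swap _ _ _ _)).
have [_ E2] := integrable_fine (integrable_fubini_F Fi').
by have := Fubini Fi; rewrite /fubini_F /= in E1 E2 *; rewrite E1 E2 => ->.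
Qed.

Lemma RFubini_bounded d1 d2 (T1 : measurableType d1) (T2 : measurableType d2)
    (m1 : {sigma_finite_measure set T1 -> \bar R})
    (m2 : {sigma_finite_measure set T2 -> \bar R})
    (f : T1 -> R) (w : T2 -> R) (K : T1 -> T2 -> R) :
  m1.-integrable setT (EFin \o f) -> m2.-integrable setT (EFin \o w) ->
  measurable_fun setT (fun z : T1 * T2 => K z.1 z.2) ->
  (forall x y, `|K x y| <= 1) ->
  \int[m1]_x (f x * \int[m2]_y (w y * K x y)) =
  \int[m2]_y (w y * \int[m1]_x (f x * K x y)).
Proof.
move=> fi wi mK K1.
have mf : measurable_fun setT f by apply/measurable_EFinP; exact: (measurable_int m1).
have mw : measurable_fun setT w by apply/measurable_EFinP; exact: (measurable_int m2).
have mFw : measurable_fun setT (fun z : T1 * T2 => f z.1 * w z.2 * K z.1 z.2).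
  apply: measurable_funM => //; apply: measurable_funM.
    exact: measurableT_comp.
  exact: measurableT_comp.
have mKy x : measurable_fun setT (K x).
  exact: (measurableT_comp mK (measurable_pair1 x)).
have mKx y : measurable_fun setT (K ^~ y).
  exact: (measurableT_comp mK (measurable_pair2 y)).
have mabsf : measurable_fun setT (fun x => `|(f x)%:E|)%E.
  by apply/measurable_EFinP; exact: (measurableT_comp _ mf).
have mabsw : measurable_fun setT (fun y => `|(w y)%:E|)%E.
  by apply/measurable_EFinP; exact: (measurableT_comp _ mw).
have Fi : (m1 \x m2)%E.-integrable setT
    (EFin \o (fun z : T1 * T2 => f z.1 * w z.2 * K z.1 z.2)).
  apply/integrable12ltyP; first exact/measurable_EFinP.
  apply: (@le_lt_trans _ _ (\int[m1]_x (`|(f x)%:E| * \int[m2]_y `|(w y)%:E|)))%E.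
    apply: ge0_le_integral => //.
    - by move=> x _; exact: integral_ge0.
    - apply: (measurable_fun_fubini_tonelli_F
        (abse \o (EFin \o (fun z : T1 * T2 => f z.1 * w z.2 * K z.1 z.2)))).
        by apply/measurable_EFinP; exact: (measurableT_comp _ mFw).
      by move=> z /=; rewrite lee_fin normr_ge0.
    - exact: emeasurable_funM.
    - move=> x _; rewrite -ge0_integralZl//.
      apply: ge0_le_integral => //.
      + apply/measurable_EFinP; apply: measurableT_comp => //.
        rewrite /=; apply: measurable_funM => //; exact: measurable_funM.
      + exact: emeasurable_funM.
      + move=> y _; rewrite /= -EFinM lee_fin !normrM.
        by rewrite ler_piMr// mulr_ge0.
  have /integrableP[_ fy] := fi; have /integrableP[_ wy] := wi.
  have w0 : (0 <= \int[m2]_y `|(w y)%:E|)%E by exact: integral_ge0.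
  rewrite ge0_integralZr//.
  have f0 : (0 <= \int[m1]_x `|(f x)%:E|)%E by exact: integral_ge0.
  by apply: lte_mul_pinfty => //; rewrite ge0_fin_numE.
transitivity (\int[m1]_x \int[m2]_y (f x * w y * K x y)).
  apply: eq_Rintegral => x _; rewrite -RintegralZl//.
    by apply: eq_Rintegral => y _; rewrite mulrA.
  exact: integrable_bounded_mul.
rewrite (RFubini Fi)/=.
apply: eq_Rintegral => y _; rewrite -RintegralZl//.
  by apply: eq_Rintegral => x _; rewrite mulrA (mulrC (w y)).
exact: integrable_bounded_mul.
Qed.

End RealFubini.

(** * Uniqueness of the Fourier transform *)

Section FourierUniqueness.
Context {R : realType}.
Local Notation mu := (@lebesgue_measure R).

Variable f : R -> R.
Hypothesis fi : mu.-integrable setT (EFin \o f).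
Hypothesis f_cos : forall y, \int[mu]_t (f t * cos (t * y)) = 0.
Hypothesis f_sin : forall y, \int[mu]_t (f t * sin (t * y)) = 0.

(** The Poisson kernel of the half-plane is the average of [cos ((t - x) * y)]
over [y > 0] with weight [expR (- (l * y))], and [f] is orthogonal to each of
these cosines. *)
Lemma poisson_integral_eq0 (l x : R) : 0 < l ->
  \int[mu]_t (f t * (l / (l ^+ 2 + (t - x) ^+ 2))) = 0.
Proof.
move=> l0.
pose w := (fun y => expR (- (l * y))) \_ `[0%R, +oo[.
have wi : mu.-integrable setT (EFin \o w).
  rewrite /w -restrict_EFin; apply/integrable_restrict => //; rewrite setTI.
  exact: integrable_expRN.
pose K (t y : R) := cos ((t - x) * y).
have mK : measurable_fun setT (fun z : R * R => K z.1 z.2).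
  apply: (measurableT_comp (continuous_measurable_fun (@continuous_cos R))).
  by apply: measurable_funM => //; apply: measurable_funB.
have K1 t y : `|K t y| <= 1 by exact: normr_cos_le1.
have := RFubini_bounded fi wi mK K1.
rewrite [X in _ = X](_ : _ = 0); last first.
  rewrite (_ : (fun y => _) = cst 0); first by rewrite Rintegral_cst// mul0r.
  apply/funext => y /=.
  have ic : mu.-integrable setT (EFin \o (fun t => f t * cos (t * y))).
    apply: integrable_bounded_mul => //; last by move=> ?; exact: normr_cos_le1.
    by apply: derivable_measurableR => t; exact: ex_derive.
  have is_ : mu.-integrable setT (EFin \o (fun t => f t * sin (t * y))).
    apply: integrable_bounded_mul => //; last by move=> ?; exact: normr_sin_le1.
    by apply: derivable_measurableR => t; exact: ex_derive.
  rewrite (_ : \int[mu]_t (f t * K t y) = \int[mu]_t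
      (f t * cos (t * y) * cos (x * y) + f t * sin (t * y) * sin (x * y))).
    rewrite RintegralD//.
    - by rewrite !RintegralZr// f_cos f_sin !mul0r addr0 mulr0.
    - exact: (integrableZr measurableT (cos (x * y)) ic).
    - exact: (integrableZr measurableT (sin (x * y)) is_).
  by apply: eq_Rintegral => t _; rewrite /K mulrBl cosB; ring.
move=> <-; apply: eq_Rintegral => t _; congr (_ * _).
rewrite -Rintegral_expRNcos// Rintegral_mkcond.
by apply: eq_Rintegral => y _; rewrite /w !patchE; case: ifPn; rewrite ?mul0r.
Qed.

Lemma poisson_kernel_itv (a b l t : R) : a < b -> 0 < l ->
  \int[mu]_(x in `[a, b]) (l / (l ^+ 2 + (t - x) ^+ 2)) =
  atan ((b - t) / l) - atan ((a - t) / l).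
Proof.
move=> ab l0; pose F (x : R) := atan ((x - t) / l).
have dF (x : R) : is_derive x 1 F (l / (l ^+ 2 + (t - x) ^+ 2)).
  rewrite /F; apply: is_derive_eq; rewrite /GRing.scale /=.
  field.
  by rewrite !gt_eqF//= ltr_pwDl ?sqr_ge0// exprn_gt0.
have cF : continuous F by apply: derivable_continuousR => x; exact: ex_derive.
rewrite /Rintegral (@continuous_FTC2 _ _ F)//.
- apply: continuous_subspaceT; apply: derivable_continuousR => x.
  have d0 : l ^+ 2 + (t - x) ^+ 2 != 0.
    by rewrite gt_eqF// ltr_pwDl ?sqr_ge0// exprn_gt0.
  exact: ex_derive.
- split; first by move=> x _; exact: ex_derive.
  + exact/cvg_at_right_filter/cF.
  + exact/cvg_at_left_filter/cF.
- by move=> x _; rewrite derive1E; apply: derive_val.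
Qed.

(** Integrating the Poisson kernel over [x] in [[a, b]] gives a smooth
approximation, of width [l], of the indicator of that interval. *)
Lemma atan_integral_eq0 (a b l : R) : a < b -> 0 < l ->
  \int[mu]_t (f t * (atan ((b - t) / l) - atan ((a - t) / l))) = 0.
Proof.
move=> ab l0.
pose w : R -> R := \1_`[a, b].
have wi : mu.-integrable setT (EFin \o w) by exact: integrable_indic_itv.
(* the extra factor l makes the kernel bounded by 1 *)
pose K (t x : R) := l * (l / (l ^+ 2 + (t - x) ^+ 2)).
have d0 t x : 0 < l ^+ 2 + (t - x) ^+ 2.
  by rewrite ltr_pwDl ?sqr_ge0// exprn_gt0.
have mK : measurable_fun setT (fun z : R * R => K z.1 z.2).
  apply: measurable_funM => //; apply: measurable_funM => //.
  apply: (@measurableT_comp _ _ _ _ _ _ (fun u : R => (l ^+ 2 + u ^+ 2)^-1) _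
    (fun z : R * R => z.1 - z.2)); last exact: measurable_funB.
  apply: derivable_measurableR => u.
  have u0 : l ^+ 2 + u ^+ 2 != 0 by have := d0 u 0; rewrite subr0 => /lt0r_neq0.
  exact: ex_derive.
have K1 t x : `|K t x| <= 1.
  rewrite ger0_norm /K; last first.
    by rewrite mulr_ge0 ?(ltW l0)// divr_ge0 ?(ltW l0)// ltW.
  by rewrite mulrA -expr2 ler_pdivrMr// mul1r lerDl sqr_ge0.
have := RFubini_bounded fi wi mK K1.
rewrite [X in _ = X](_ : _ = 0); last first.
  rewrite (_ : (fun y => _) = cst 0); first by rewrite Rintegral_cst// mul0r.
  apply/funext => x /=.
  rewrite (_ : \int[mu]_t _ = 0) ?mulr0//.
  have Ki : mu.-integrable setT (EFin \o (fun t => f t * K t x)).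
    apply: integrable_bounded_mul => //.
    exact: (measurableT_comp mK (measurable_pair2 x)).
  have E : \int[mu]_t (f t * (l / (l ^+ 2 + (t - x) ^+ 2))) =
      l^-1 * \int[mu]_t (f t * K t x).
    rewrite -RintegralZl//; apply: eq_Rintegral => t _.
    by rewrite /K; field; rewrite !gt_eqF.
  move/eqP: E; rewrite poisson_integral_eq0// eq_sym mulf_eq0 invr_eq0 gt_eqF//=.
  by move/eqP.
move=> H; apply: (mulfI (lt0r_neq0 l0)); rewrite mulr0 -{}H.
rewrite -RintegralZl//.
  apply: eq_Rintegral => t _; rewrite mulrCA; congr (_ * _).
  rewrite -poisson_kernel_itv// -RintegralZl//.
    rewrite Rintegral_mkcond; apply: eq_Rintegral => x _.
    by rewrite /w indicE patchE; case: ifPn; rewrite ?mul0r ?mul1r.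
  apply: continuous_compact_integrable; first exact: segment_compact.
  apply: continuous_subspaceT; apply: derivable_continuousR => x.
  have := lt0r_neq0 (d0 t x) => ?; exact: ex_derive.
apply: (integrable_boundedM (M := pi)) => //.
  apply: measurable_funB; apply: derivable_measurableR => t; exact: ex_derive.
move=> t; rewrite ler_norml.
have := atan_gtNpi2 ((b - t) / l); have := atan_ltpi2 ((b - t) / l).
have := atan_gtNpi2 ((a - t) / l); have := atan_ltpi2 ((a - t) / l).
by move=> *; apply/andP; split; lra.
Qed.

Lemma cvg_atan_scale (c : R) :
  atan (c / n.+1%:R^-1) @[n --> \oo] --> Num.sg c * (pi / 2).
Proof.
have pos (e : R) : 0 < e -> atan (e / n.+1%:R^-1) @[n --> \oo] --> pi / 2.
  move=> e0; apply: (@cvg_comp _ _ _ (fun n : nat => e / n.+1%:R^-1) atan _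
    (pinfty_nbhs R)); last exact: cvgy_atan.
  under eq_fun do rewrite invrK.
  apply: (@cvg_comp _ _ _ (fun n : nat => n.+1%:R : R) (fun x => e * x) _
    (pinfty_nbhs R)); last exact: gt0_cvgMry.
  by rewrite (cvg_shiftS (fun n : nat => n%:R : R)); exact: cvgr_idn.
have [c0|c0|<-] := ltgtP 0 c.
- by rewrite gtr0_sg// mul1r; exact: pos.
- rewrite ltr0_sg// mulN1r.
  have c0' : 0 < - c by rewrite oppr_gt0.
  rewrite (_ : (fun n : nat => _) = (fun n => - atan (- c / n.+1%:R^-1))).
    by apply: cvgN; apply: pos.
  by apply: funext => n; rewrite mulNr atanN opprK.
- rewrite sgr0 mul0r; under eq_fun do rewrite mul0r atan0; exact: cvg_cst.
Qed.

Lemma measurable_sgr (c : R) : measurable_fun setT (fun t : R => Num.sg (c - t)).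
Proof.
rewrite (_ : (fun t => _) = (\1_`]-oo, c[ \- \1_`]c, +oo[)%R).
  exact: measurable_funB.
apply/funext => t; rewrite /= !indicE !mem_setE !in_itv/= andbT.
have [tc|tc|->] := ltgtP t c.
- by rewrite gtr0_sg ?subr_gt0// subr0.
- by rewrite ltr0_sg ?subr_lt0// sub0r.
- by rewrite subrr sgr0 subrr.
Qed.

(** The limit of [atan_integral_eq0] as [l] tends to 0, by dominated
convergence. *)
Lemma sgn_integral_eq0 (a b : R) : a < b ->
  \int[mu]_t (f t * ((Num.sg (b - t) - Num.sg (a - t)) * (pi / 2))) = 0.
Proof.
move=> ab.
have mf : measurable_fun setT f by apply/measurable_EFinP; exact: (measurable_int mu).
pose h (n : nat) t := f t * (atan ((b - t) / n.+1%:R^-1) - atan ((a - t) / n.+1%:R^-1)).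
have mh n : measurable_fun setT (EFin \o h n).
  apply/measurable_EFinP; apply: measurable_funM => //.
  apply: measurable_funB; apply: derivable_measurableR => t; exact: ex_derive.
have hub n t : `|h n t| <= pi * `|f t|.
  rewrite normrM mulrC ler_wpM2r// ler_norml.
  have := atan_gtNpi2 ((b - t) / n.+1%:R^-1); have := atan_ltpi2 ((b - t) / n.+1%:R^-1).
  have := atan_gtNpi2 ((a - t) / n.+1%:R^-1); have := atan_ltpi2 ((a - t) / n.+1%:R^-1).
  by move=> *; apply/andP; split; lra.
have gi : mu.-integrable setT (EFin \o (fun t => pi * `|f t|)).
  exact: (integrableZl measurableT pi (integrable_abse fi)).
have h0 n : (\int[mu]_t (h n t)%:E = 0)%E.
  have n0 : (0 : R) < n.+1%:R^-1 by rewrite invr_gt0.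
  have hi : mu.-integrable setT (EFin \o h n).
    apply: (le_integrable measurableT _ _ gi); first exact: mh.
    move=> t _ /=; rewrite lee_fin [leRHS]ger0_norm ?hub//.
    by rewrite mulr_ge0 ?pi_ge0.
  have hfin := integrable_fin_num measurableT hi.
  by rewrite -[LHS](fineK hfin); congr EFin; exact: atan_integral_eq0 ab n0.
pose hl t := f t * ((Num.sg (b - t) - Num.sg (a - t)) * (pi / 2)).
have H : (\int[mu]_t (h n t)%:E @[n --> \oo] --> \int[mu]_t (hl t)%:E)%E.
  apply: (@dominated_cvg _ _ _ mu setT measurableT (fun n => EFin \o h n)
    (EFin \o hl) (EFin \o (fun t => pi * `|f t|))) => //.
  - move=> t _; apply: cvg_EFin; first exact: nearW.
    by apply: cvgMr; rewrite mulrBl; apply: cvgB; exact: cvg_atan_scale.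
  - by move=> n t _; rewrite /= lee_fin hub.
rewrite /Rintegral (_ : \int[mu]_t (hl t)%:E = 0)%E//.
have H0 : (\int[mu]_t (h n t)%:E @[n --> \oo] --> 0)%E.
  by rewrite (_ : (fun n => _) = cst 0%E); [exact: cvg_cst|exact: funext].
by rewrite -(cvg_lim (@ereal_hausdorff R) H) (cvg_lim (@ereal_hausdorff R) H0).
Qed.

Lemma itv_integral_eq0 (a b : R) : a < b -> \int[mu]_(t in `]a, b]) f t = 0.
Proof.
move=> ab.
have mf : measurable_fun setT f by apply/measurable_EFinP; exact: (measurable_int mu).
apply: (mulfI (lt0r_neq0 (pi_gt0 R))); rewrite mulr0 -(sgn_integral_eq0 ab).
rewrite Rintegral_mkcond -RintegralZl//; last first.
  by rewrite -restrict_EFin; apply/integrable_restrict => //; rewrite setTI;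
    exact: (integrableS measurableT).
rewrite /Rintegral; congr fine; apply: ae_eq_integral => //.
- apply/measurable_EFinP; apply: measurable_funM => //.
  apply/(measurable_restrictT _ (measurable_itv _)); exact: measurable_funTS mf.
- apply/measurable_EFinP; apply: measurable_funM => //.
  apply: measurable_funM => //.
  by apply: measurable_funB; exact: measurable_sgr.
- exists [set a; b]; split.
  + exact: measurableU.
  + by apply: countable_lebesgue_measure0; exact/finite_set_countable/finite_set2.
  + move=> t /= /not_implyP[_ ne]; apply: contrapT => /not_orP[/eqP ta /eqP tb].
    apply: ne; rewrite patchE mem_setE in_itv/=; congr EFin.
    have [at_|ta_|/eqP] := ltgtP a t; last by rewrite eq_sym (negbTE ta).
      have [tb_|bt_|/eqP] := ltgtP t b; last by rewrite (negbTE tb).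
        by rewrite gtr0_sg ?subr_gt0// ltr0_sg ?subr_lt0//=; field.
      by rewrite ltr0_sg ?subr_lt0// ltr0_sg ?subr_lt0//= subrr mul0r !mulr0.
    have tb_ := lt_trans ta_ ab.
    by rewrite gtr0_sg ?subr_gt0// gtr0_sg ?subr_gt0//= subrr mul0r !mulr0.
Qed.

(** By [itv_integral_eq0] the primitive of [f] is constant, and by Lebesgue's
differentiation theorem its derivative is [f] almost everywhere. *)
Lemma fourier_uniqueness : {ae mu, forall t, f t = 0}.
Proof.
have fS A : measurable A -> mu.-integrable A (EFin \o f).
  by move=> mA; exact: (integrableS measurableT).
have loc : locally_integrable setT f by apply: open_integrable_locally => //; exact: openT.
have /= := FTC1Ny (fun y => fS _ (measurable_itv _)) loc.
rewrite (_ : (fun x : R => _) = cst (\int[mu]_(t in `]-oo, 0]) f t)).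
  apply: (@filterS _ _ (ae_filter_ringOfSetsType mu)) => x [_ <-].
  by rewrite derive1_cst.
have E (x y : R) : x < y ->
    \int[mu]_(t in `]-oo, x]) f t = \int[mu]_(t in `]-oo, y]) f t.
  move=> xy; apply/esym/eqP; rewrite -subr_eq0.
  rewrite Rintegral_itvB ?bnd_simp ?ltW//; last by apply: fS; exact: measurable_itv.
  by rewrite itv_integral_eq0.
apply/funext => x /=.
by have [/E|/E|->] := ltgtP x 0.
Qed.

End FourierUniqueness.

(** * Convolution of an integrable function with a finite measure *)

Section Convolution.
Context {R : realType}.
Local Notation mu := (@lebesgue_measure R).

Lemma ge0_integral_translate (h : R -> \bar R) (s : R) :
  measurable_fun setT h -> (forall t, 0 <= h t)%E ->
  (\int[mu]_t h (t - s)%R = \int[mu]_t h t)%E.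
Proof.
move=> mh h0.
have mT : measurable_fun setT (fun t : measurableTypeR R => (t - s : measurableTypeR R)).
  by apply: measurable_funB.
have := @ge0_integral_pushforward _ _ (measurableTypeR R) (measurableTypeR R) R _ mT
  mu setT h measurableT mh (fun y _ => h0 y).
rewrite preimage_setT => <-.
apply: eq_measure_integral => A mA _; symmetry.
apply: lebesgue_measure_unique => // X [[a b] _ <-].
rewrite /= /pushforward lebesgue_measure_itv/=.
rewrite (_ : _ @^-1` _ = `]a + s, b + s]%classic); last first.
  by apply/seteqP; split => x; rewrite /= !in_itv/= ltrBrDr lerBlDr.
by rewrite lebesgue_measure_itv/= !lte_fin ltrD2r -!EFinB opprD addrACA subrr addr0.
Qed.

Lemma Rintegral_translate (h : R -> R) (s : R) :
  mu.-integrable setT (EFin \o h) ->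
  mu.-integrable setT (EFin \o (fun t => h (t - s))) /\
  \int[mu]_t h (t - s) = \int[mu]_t h t.
Proof.
move=> hi; have mh := measurable_int mu hi.
have mT : measurable_fun setT (fun t : R => t - s) by apply: measurable_funB.
split.
  apply/integrableP; split; first exact: (measurableT_comp mh mT).
  have -> := @ge0_integral_translate (abse \o (EFin \o h)) s.
  - by have /integrableP[] := hi.
  - exact: (measurableT_comp _ mh).
  - by move=> t; exact: abse_ge0.
rewrite /Rintegral integralE [in RHS]integralE.
congr (fine (_ - _)%E).
- rewrite -(@ge0_integral_translate _ s (measurable_funepos mh)) => [|t].
    by apply: eq_integral => t _; rewrite !funeposE.
  exact: funepos_ge0.
- rewrite -(@ge0_integral_translate _ s (measurable_funeneg mh)) => [|t].
    by apply: eq_integral => t _; rewrite !funenegE.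
  exact: funeneg_ge0.
Qed.

Variable m : {sigma_finite_measure set (measurableTypeR R) -> \bar R}.
Variable k : R -> R.
Hypothesis k0 : forall s, 0 <= k s.
Hypothesis ki : m.-integrable setT (EFin \o k).

(** A density [k] against a general measure [m] covers both convolutions of the
renewal equation: with the positive part of phi and with an exponential
density. *)
Definition convolution (f : R -> R) (t : R) : R := \int[m]_s (f (t - s) * k s).

Variable f : R -> R.
Hypothesis fi : mu.-integrable setT (EFin \o f).

Let mk : measurable_fun setT k.
Proof. by apply/measurable_EFinP; exact: (measurable_int m). Qed.

Let mf : measurable_fun setT f.
Proof. by apply/measurable_EFinP; exact: (measurable_int mu). Qed.

Let mF : measurable_fun setT (fun z : R * R => f (z.1 - z.2) * k z.2).
Proof.
apply: measurable_funM; last exact: (measurableT_comp mk).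
by apply: (measurableT_comp mf); exact: measurable_funB.
Qed.

Let absf := (\int[mu]_t `|(f t)%:E|)%E.

Let absf_ge0 : (0 <= absf)%E. Proof. exact: integral_ge0. Qed.

Let absf_fin : absf \is a fin_num.
Proof. by rewrite ge0_fin_numE//; have /integrableP[] := fi. Qed.

Let int_absF : (\int[m]_s \int[mu]_t `|(f (t - s) * k s)%:E| =
  absf * \int[m]_s (k s)%:E)%E.
Proof.
have E s : (\int[mu]_t `|(f (t - s) * k s)%:E| = absf * (k s)%:E)%E.
  transitivity (\int[mu]_t (`|(f (t - s))%:E| * (k s)%:E))%E.
    by apply: eq_integral => t _; rewrite EFinM abseM [X in (_ * X)%E]gee0_abs ?lee_fin.
  have mabs : measurable_fun setT (fun t : R => `|(f t)%:E|%E).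
    by apply/measurable_EFinP; exact: measurableT_comp.
  rewrite ge0_integralZr//; last 2 first.
  - apply: (measurableT_comp mabs); exact: measurable_funB.
  - by rewrite lee_fin.
  by rewrite (@ge0_integral_translate (fun t => `|(f t)%:E|%E) s).
under eq_integral do rewrite E.
rewrite ge0_integralZl//.
- exact/measurable_EFinP.
- by move=> s _; rewrite lee_fin.
Qed.

Let intk_fin : (\int[m]_s (k s)%:E)%E \is a fin_num.
Proof. exact: integrable_fin_num. Qed.

Let Fi : (mu \x m)%E.-integrable setT
  (EFin \o (fun z : R * R => f (z.1 - z.2) * k z.2)).
Proof.
apply/integrable21ltyP; first exact/measurable_EFinP.
by rewrite int_absF ltey_eq fin_numM.
Qed.

Lemma integrable_convolution : mu.-integrable setT (EFin \o convolution f).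
Proof. exact: (integrable_fine (integrable_fubini_F Fi)).1. Qed.

(** Young's inequality in L1: Tonelli and translation invariance. *)
Lemma norm_convolution_le :
  \int[mu]_t `|convolution f t| <= \int[mu]_t `|f t| * \int[m]_s k s.
Proof.
have ci := integrable_convolution.
rewrite -lee_fin EFinM /Rintegral fineK; last first.
  by apply: integrable_fin_num => //; exact: (integrable_abse ci).
rewrite -[(\int[mu]_t `|f t|%:E)%E]/absf !fineK// -int_absF.
have mAF : measurable_fun setT
    (fun z : R * R => `|(f (z.1 - z.2) * k z.2)%:E|%E).
  by apply/measurable_EFinP; exact: measurableT_comp mF.
have AF0 (z : R * R) : (0 <= `|(f (z.1 - z.2) * k z.2)%:E|)%E by exact: abse_ge0.
rewrite -(@fubini_tonelli _ _ _ _ _ mu m _ mAF AF0)/=.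
apply: ge0_le_integral => //.
- have /integrableP[/measurable_EFinP mc _] := ci.
  by apply/measurable_EFinP; exact: measurableT_comp mc.
- exact: (@measurable_fun_fubini_tonelli_F _ _ _ _ _ m _ mAF AF0).
move=> t _; rewrite /convolution /Rintegral.
have mFt : measurable_fun setT (fun s : R => (f (t - s) * k s)%:E).
  apply/measurable_EFinP; exact: (measurableT_comp mF (measurable_pair1 t)).
apply: le_trans (le_abse_integral m measurableT mFt).
by case: (integral _ _ _) => [r| |] //=; rewrite normr0 leey.
Qed.

(** Fubini, then the substitution of [t + s] for [t]. *)
Lemma Rintegral_convolution (psi : R -> R) : measurable_fun setT psi ->
  (forall t, `|psi t| <= 1) ->
  \int[mu]_t (convolution f t * psi t) =
  \int[m]_s (k s * \int[mu]_t (f t * psi (t + s))).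
Proof.
move=> mpsi psi1.
pose Fp (z : R * R) := f (z.1 - z.2) * k z.2 * psi z.1.
have Fpi : (mu \x m)%E.-integrable setT (EFin \o Fp).
  by apply: integrable_bounded_mul => //; exact: measurableT_comp.
transitivity (\int[mu]_t \int[m]_s Fp (t, s)).
  have [c1 _] := integrable_fine (integrable_fubini_F Fpi).
  rewrite /Rintegral; congr fine; apply: ae_eq_integral => //.
  - apply/measurable_EFinP; apply: measurable_funM => //.
    by apply/measurable_EFinP; exact: (measurable_int mu integrable_convolution).
  - exact: (measurable_int mu c1).
  - have := ae_integrable1 Fi.
    apply: (@filterS _ _ (ae_filter_ringOfSetsType mu)) => t it _.
    by rewrite -[in RHS]/(\int[m]_s Fp (t, s)) /Fp /= RintegralZr.
rewrite (RFubini Fpi); apply: eq_Rintegral => s _.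
have fpi : mu.-integrable setT (EFin \o (fun t => f t * psi (t + s))).
  apply: integrable_bounded_mul => //.
  by apply: (measurableT_comp mpsi); exact: measurable_funD.
have [i1 E1] := Rintegral_translate s fpi.
rewrite -E1 -RintegralZl//.
by apply: eq_Rintegral => t _; rewrite /Fp /= subrK; ring.
Qed.

Lemma Rintegral_convolution_cos (y : R) :
  \int[mu]_t (convolution f t * cos (t * y)) =
  \int[mu]_t (f t * cos (t * y)) * \int[m]_s (k s * cos (s * y)) -
  \int[mu]_t (f t * sin (t * y)) * \int[m]_s (k s * sin (s * y)).
Proof.
have mc : measurable_fun setT (fun t : R => cos (t * y)).
  by apply: derivable_measurableR => t; exact: ex_derive.
have ms : measurable_fun setT (fun t : R => sin (t * y)).
  by apply: derivable_measurableR => t; exact: ex_derive.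
have c1 (t : R) : `|cos (t * y)| <= 1 := normr_cos_le1 _.
have s1 (t : R) : `|sin (t * y)| <= 1 := normr_sin_le1 _.
have fc := integrable_bounded_mul measurableT fi mc c1.
have fs := integrable_bounded_mul measurableT fi ms s1.
have kc := integrable_bounded_mul measurableT ki mc c1.
have ks := integrable_bounded_mul measurableT ki ms s1.
rewrite Rintegral_convolution// -!RintegralZl// -RintegralB//; last 2 first.
- exact: (integrableZl measurableT _ kc).
- exact: (integrableZl measurableT _ ks).
apply: eq_Rintegral => s _.
transitivity (k s * (\int[mu]_t (f t * cos (t * y)) * cos (s * y) -
  \int[mu]_t (f t * sin (t * y)) * sin (s * y))); last by ring.
congr (_ * _); rewrite -!RintegralZr// -RintegralB//; last 2 first.
- exact: (integrableZr measurableT _ fc).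
- exact: (integrableZr measurableT _ fs).
by apply: eq_Rintegral => t _; rewrite mulrDl cosD; ring.
Qed.

Lemma Rintegral_convolution_sin (y : R) :
  \int[mu]_t (convolution f t * sin (t * y)) =
  \int[mu]_t (f t * sin (t * y)) * \int[m]_s (k s * cos (s * y)) +
  \int[mu]_t (f t * cos (t * y)) * \int[m]_s (k s * sin (s * y)).
Proof.
have mc : measurable_fun setT (fun t : R => cos (t * y)).
  by apply: derivable_measurableR => t; exact: ex_derive.
have ms : measurable_fun setT (fun t : R => sin (t * y)).
  by apply: derivable_measurableR => t; exact: ex_derive.
have c1 (t : R) : `|cos (t * y)| <= 1 := normr_cos_le1 _.
have s1 (t : R) : `|sin (t * y)| <= 1 := normr_sin_le1 _.
have fc := integrable_bounded_mul measurableT fi mc c1.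
have fs := integrable_bounded_mul measurableT fi ms s1.
have kc := integrable_bounded_mul measurableT ki mc c1.
have ks := integrable_bounded_mul measurableT ki ms s1.
rewrite Rintegral_convolution// -!RintegralZl// -RintegralD//; last 2 first.
- exact: (integrableZl measurableT _ kc).
- exact: (integrableZl measurableT _ ks).
apply: eq_Rintegral => s _.
transitivity (k s * (\int[mu]_t (f t * sin (t * y)) * cos (s * y) +
  \int[mu]_t (f t * cos (t * y)) * sin (s * y))); last by ring.
congr (_ * _); rewrite -!RintegralZr// -RintegralD//; last 2 first.
- exact: (integrableZr measurableT _ fs).
- exact: (integrableZr measurableT _ fc).
by apply: eq_Rintegral => t _; rewrite mulrDl sinD; ring.
Qed.

End Convolution.

Local Open Scope complex_scope.

(** * The function h_phi on the real and on the imaginary axis *)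

Section CharacteristicFunction.
Context {R : realType} (phi : signed_measure R).
Hypothesis phi_ge0 : forall B : set (measurableTypeR R), measurable B ->
  (0 <= sm_val phi (B `&` `]0%R, +oo[%classic))%E.
Local Notation mu := (@lebesgue_measure R).
Local Notation pos := (sm_pos phi).
Local Notation neg := (sm_neg phi).

(** The negative part lives where the positive part vanishes, and there the
sign hypothesis bounds its mass on ]0, +oo[ by 0. *)
Lemma sm_neg_itv0y : neg `]0%R, +oo[%classic = 0%E.
Proof.
have [A [mA posA negA]] := sm_singular phi.
have mI : measurable (`]0%R, +oo[%classic : set (measurableTypeR R)).
  exact: measurable_itv.
have mAI : measurable (~` A `&` `]0%R, +oo[%classic : set (measurableTypeR R)).
  by apply: measurableI => //; exact: measurableC.
have pos0 : pos (~` A `&` `]0%R, +oo[%classic) = 0%E.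
  apply/eqP; rewrite -measure_le0 -posA; apply: le_measure; rewrite ?inE//.
  exact: measurableC.
have neg0 : neg (~` A `&` `]0%R, +oo[%classic) = 0%E.
  apply/eqP; rewrite -measure_le0.
  have := phi_ge0 (measurableC mA); rewrite /sm_val pos0 sub0e.
  by rewrite oppe_ge0.
apply/eqP; rewrite -measure_le0.
rewrite -(setTI `]0%R, +oo[%classic) -(setUv A) setIUl.
rewrite (le_trans (measureU2 _ _ _))//; first exact: measurableI.
rewrite [X in (_ + X)%E]neg0 adde0 -negA; apply: le_measure; rewrite ?inE//.
exact: measurableI.
Qed.

Let n : R := fine (neg `[0%R, +oo[%classic).

(** By [sm_neg_itv0y] the negative part is a multiple of the Dirac mass at 0. *)
Lemma sm_neg_integral (u : R -> R) : measurable_fun setT u ->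
  \int[neg]_(t in `[0%R, +oo[) u t = n * u 0.
Proof.
move=> mu_.
transitivity (\int[neg]_(t in `[0%R, +oo[) u 0).
  rewrite /Rintegral; congr fine; apply: ae_eq_integral => //.
  - by apply/measurable_EFinP; exact: measurable_funTS.
  exists `]0%R, +oo[%classic; split => //; first exact: sm_neg_itv0y.
  move=> t /= /not_implyP[]; rewrite !in_itv/= !andbT le_eqVlt => /orP[/eqP<-//|//].
by rewrite Rintegral_cst// mulrC.
Qed.

Lemma sm_pos_integrable (u : R -> R) (M : R) (D : set (measurableTypeR R)) :
  measurable D -> measurable_fun setT u ->
  (forall t, D t -> `|u t| <= M) -> pos.-integrable D (EFin \o u).
Proof.
move=> mD mu_ uM.
have cM : pos.-integrable D (EFin \o cst M) by exact: finite_measure_integrable_cst.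
apply: (le_integrable mD _ _ cM).
  by apply/measurable_EFinP; exact: measurable_funTS.
by move=> t Dt /=; rewrite lee_fin (le_trans (uM t Dt)) ?ler_norm.
Qed.

(** This is h_phi on the real axis; see [h_fun_laplace]. *)
Definition shifted_laplace (x : R) : R :=
  x + n - \int[pos]_(t in `[0%R, +oo[) expR (- (x * t)).

Lemma h_fun_laplace (x : R) : h_fun phi x%:C = (shifted_laplace x)%:C.
Proof.
have re t : complex.Re (cexp (- x%:C * t%:C)) = expR (- (x * t)).
  by rewrite /cexp /= !(mulr0, mul0r, oppr0, addr0, subr0, cos0, sin0, mulr1) mulNr.
have E1 (m : {measure set (measurableTypeR R) -> \bar R}) :
    \int[m]_(t in `[0%R, +oo[) complex.Re (cexp (- x%:C * t%:C)) =
    \int[m]_(t in `[0%R, +oo[) expR (- (x * t)).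
  by apply: eq_Rintegral => t _; exact: re.
have Re_h : complex.Re (h_fun phi x%:C) = shifted_laplace x.
  rewrite /h_fun /sm_cintegral /cintegral !E1 sm_neg_integral; last first.
    by apply: derivable_measurableR => t; exact: ex_derive.
  by rewrite /= /shifted_laplace mulr0 oppr0 expR0; ring.
have := h_fun_real phi x; move: Re_h.
by case: (h_fun phi x%:C) => a b /= -> ->.
Qed.

Lemma h_fun_imaginary (y : R) : h_fun phi (0 +i* y) =
  (n - \int[pos]_(t in `[0%R, +oo[) cos (t * y)) +i*
  (y + \int[pos]_(t in `[0%R, +oo[) sin (t * y)).
Proof.
have re t : complex.Re (cexp (- (0 +i* y) * t%:C)) = cos (t * y).
  rewrite /cexp /= !(mulr0, mul0r, oppr0, addr0, subr0, add0r, expR0, mul1r).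
  by rewrite mulNr cosN mulrC.
have im t : complex.Im (cexp (- (0 +i* y) * t%:C)) = - sin (t * y).
  rewrite /cexp /= !(mulr0, mul0r, oppr0, addr0, subr0, add0r, expR0, mul1r).
  by rewrite mulNr sinN mulrC.
rewrite /h_fun /sm_cintegral /cintegral.
have mc : measurable_fun setT (fun t : R => cos (t * y)).
  by apply: derivable_measurableR => t; exact: ex_derive.
have ms : measurable_fun setT (fun t : R => - sin (t * y)).
  by apply: derivable_measurableR => t; exact: ex_derive.
have E1 (m : {measure set (measurableTypeR R) -> \bar R}) :
    \int[m]_(t in `[0%R, +oo[) complex.Re (cexp (- (0 +i* y) * t%:C)) =
    \int[m]_(t in `[0%R, +oo[) cos (t * y) by apply: eq_Rintegral => t _; exact: re.
have E2 (m : {measure set (measurableTypeR R) -> \bar R}) :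
    \int[m]_(t in `[0%R, +oo[) complex.Im (cexp (- (0 +i* y) * t%:C)) =
    \int[m]_(t in `[0%R, +oo[) - sin (t * y) by apply: eq_Rintegral => t _; exact: im.
rewrite !E1 !E2 !sm_neg_integral// mul0r cos0 sin0 oppr0 !mulr0 mulr1.
have E3 : \int[pos]_(t in `[0%R, +oo[) - sin (t * y) =
    - \int[pos]_(t in `[0%R, +oo[) sin (t * y).
  have si : pos.-integrable `[0%R, +oo[ (EFin \o (fun t => sin (t * y))).
    apply: (@sm_pos_integrable _ 1) => //; last by move=> t _; exact: normr_sin_le1.
    by apply: derivable_measurableR => t; exact: ex_derive.
  under eq_Rintegral do rewrite -mulN1r.
  by rewrite RintegralZl// mulN1r.
by rewrite E3; apply/eqP; rewrite eq_complex /=; apply/andP; split; apply/eqP; ring.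
Qed.

End CharacteristicFunction.

(** * Complete monotonicity *)

Section CompleteMonotonicity.
Context {R : realType}.
Implicit Types f g : R -> R.

(** Complete monotonicity up to order [n] on ]0, +oo[. Witnessing each
derivative by a function, instead of iterating [derive1], makes the stability
under sums and products a plain induction. *)
Fixpoint alternating (n : nat) f : Prop :=
  (forall x, 0 < x -> 0 <= f x) /\
  if n is n'.+1 then
    exists f1, (forall x : R, 0 < x -> is_derive x 1 f (- f1 x)) /\ alternating n' f1
  else True.

Lemma alternatingW n f : alternating n.+1 f -> alternating n f.
Proof.
elim: n f => [|n IH] f [f0 [f1 [df altf1]]]; first by split.
by split => //; exists f1; split => //; exact: IH.
Qed.

Lemma alternating_cst n (c : R) : 0 <= c -> alternating n (cst c).
Proof.
elim: n c => [|n IH] c c0; first by split.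
split => //; exists (cst 0); split; last exact: IH.
by move=> x _; rewrite /= oppr0; exact: is_derive_cst.
Qed.

Lemma alternatingD n f g : alternating n f -> alternating n g ->
  alternating n (fun x => f x + g x).
Proof.
elim: n f g => [|n IH] f g.
  by move=> [f0 _] [g0 _]; split => // x x0; rewrite addr_ge0 ?f0 ?g0.
move=> [f0 [f1 [df altf1]]] [g0 [g1 [dg altg1]]]; split.
  by move=> x x0; rewrite addr_ge0 ?f0 ?g0.
exists (fun x => f1 x + g1 x); split; last exact: IH.
by move=> x x0; rewrite opprD; have := df x x0; have := dg x x0 => ? ?; exact: is_deriveD.
Qed.

Lemma alternatingM n f g : alternating n f -> alternating n g ->
  alternating n (fun x => f x * g x).
Proof.
elim: n f g => [|n IH] f g.
  by move=> [f0 _] [g0 _]; split => // x x0; rewrite mulr_ge0 ?f0 ?g0.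
move=> altf altg; have := alternatingW altf; have := alternatingW altg.
move: altf altg => [f0 [f1 [df altf1]]] [g0 [g1 [dg altg1]]] altg altf; split.
  by move=> x x0; rewrite mulr_ge0 ?f0 ?g0.
exists (fun x => f x * g1 x + g x * f1 x); split.
  move=> x x0; have := df x x0; have := dg x x0 => ? ?.
  have := is_deriveM (f := f) (g := g) (x := x) (v := 1).
  move=> H; apply: is_derive_eq; rewrite /GRing.scale /=; ring.
by apply: alternatingD; exact: IH.
Qed.

(** The equation f' = - f1 f^2 passes one order of monotonicity after the other
from the right-hand side to f. It is the equation of f = 1 / h, with f1 = h'. *)
Lemma alternating_riccati f f1 :
  (forall x, 0 < x -> 0 <= f x) ->
  (forall x : R, 0 < x -> is_derive x 1 f (- (f1 x * (f x * f x)))) ->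
  (forall n, alternating n f1) -> forall n, alternating n f.
Proof.
move=> f0 df altf1; elim => [|n IH]; first by split.
split => //; exists (fun x => f1 x * (f x * f x)); split => //.
by apply: alternatingM => //; exact: alternatingM.
Qed.

(** The factor [c] absorbs the sign that each differentiation produces, so that
the induction on [n] goes through. *)
Lemma alternating_derive1n n f (u : R -> R) (c x : R) : alternating n.+1 f ->
  (forall y, 0 < y -> u y = c * f y) -> 0 < x ->
  derivable (derive1n n u) x 1 /\
  exists2 r, 0 <= r & derive1n n u x = (-1) ^+ n * c * r.
Proof.
move=> + + x0.
have near_pos (v w : R -> R) (y : R) : 0 < y -> (forall z : R, 0 < z -> v z = w z) ->
    \near y, v y = w y.
  by move=> y0 vw; near=> z; apply: vw; near: z; exact: lt_nbhsr.
elim: n f u c => [|n IH] f u c [f0 [f1 [df altf1]]] uf.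
  split; last by exists (f x); [exact: f0|rewrite expr0 mul1r -uf].
  apply: (near_eq_derivable (f := fun y => c * f y)).
    by apply: near_pos => // z z0; exact/esym/uf.
  have := df x x0 => ?; exact: ex_derive.
have [//||dn [r r0 E]] := IH f1 (u^`())%classic (- c); last first.
  by rewrite derive1Sn; split => //; exists r; rewrite // E exprS; ring.
move=> y y0; rewrite derive1E (near_eq_derive (f := u) (g := fun y => c * f y)).
  have := df y y0 => ?; apply: derive_val.
  by apply: is_derive_eq; rewrite /GRing.scale /=; ring.
exact: near_pos.
Unshelve. all: by end_near. Qed.

Lemma alternating_completely_monotone f :
  (forall n, alternating n f) -> completely_monotone f.
Proof.
move=> altf n x x0.
have [dn [r r0 ->]] := alternating_derive1n (c := 1) (altf n.+1)
  (fun y _ => esym (mul1r (f y))) x0.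
by split => //; rewrite mulr1 mulrA -expr2 sqrr_sign mul1r.
Qed.

Variable phi : signed_measure R.
Local Notation pos := (sm_pos phi).

Definition laplace_moment (k : nat) (x : R) : R :=
  \int[pos]_(t in `[0%R, +oo[) (t ^+ k * expR (- (x * t))).

(** With a = x / (k + 1), write the product as (t exp(-at))^k exp(-at) and use
a t exp(-at) <= 1. *)
Lemma moment_expR_le (k : nat) (x t : R) : 0 < x -> 0 <= t ->
  0 <= t ^+ k * expR (- (x * t)) <= (k.+1%:R / x) ^+ k.
Proof.
move=> x0 t0; apply/andP; split; first by rewrite mulr_ge0 ?exprn_ge0 ?expR_ge0.
pose a := x / k.+1%:R.
have a0 : 0 < a by rewrite divr_gt0.
have -> : expR (- (x * t)) = expR (- (a * t)) ^+ k.+1.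
  by rewrite -expRM_natl /a; congr expR; rewrite mulrN mulrA (mulrC _ (x / _)) divfK ?pnatr_eq0.
have e1 : expR (- (a * t)) <= 1.
  by rewrite -expR0 ler_expR oppr_le0 mulr_ge0// ltW.
rewrite exprS mulrCA -exprMn -[leRHS]mul1r ler_pM ?expR_ge0 ?exprn_ge0 ?mulr_ge0 ?expR_ge0//.
rewrite lerXn2r ?nnegrE ?mulr_ge0 ?expR_ge0 ?invr_ge0 ?(ltW x0)//.
have -> : k.+1%:R / x = a^-1 by rewrite /a invf_div.
rewrite expRN ler_pdivrMr ?expR_gt0// (mulrC a^-1) ler_pdivlMr// mulrC.
by rewrite (le_trans _ (expR_ge1Dx _))// lerDr.
Qed.

Lemma measurable_moment (k : nat) (x : R) :
  measurable_fun setT (fun t : R => t ^+ k * expR (- (x * t))).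
Proof.
apply: measurable_funM; first exact: exprn_measurable.
by apply: derivable_measurableR => t; exact: ex_derive.
Qed.

Lemma laplace_moment_ge0 k x : 0 <= laplace_moment k x.
Proof.
apply: Rintegral_ge0 => t; rewrite /= in_itv/= andbT => t0.
by rewrite mulr_ge0 ?expR_ge0 ?exprn_ge0.
Qed.

(** Differentiation under the integral sign: for [y] near [x] the exponent
stays above [x / 2], and [moment_expR_le] gives a constant dominating function,
which is integrable for a finite measure. *)
Lemma is_derive_laplace_moment k (x : R) : 0 < x ->
  is_derive x 1 (laplace_moment k) (- laplace_moment k.+1 x).
Proof.
move=> x0.
pose f (y t : R) := t ^+ k * expR (- (y * t)).
have df (y t : R) : is_derive y 1 (f ^~ t) (- (t ^+ k.+1 * expR (- (y * t)))).
  by rewrite /f; apply: is_derive_eq; rewrite /GRing.scale /= exprSr; ring.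
pose G (t : R) : R := (k.+2%:R / (x / 2)) ^+ k.+1.
have x2 : 0 < x / 2 by rewrite divr_gt0.
have Ix : `](x / 2), (x + 1)[%classic x by rewrite /= in_itv/=; apply/andP; split; lra.
have bnd (j : nat) (y : R) : `](x / 2), (x + 1)[%classic y -> forall t : R,
    `[0%R, +oo[%classic t -> `|t ^+ j * expR (- (y * t))| <= (j.+1%:R / (x / 2)) ^+ j.
  rewrite /= in_itv/= => /andP[xy _] t; rewrite in_itv/= andbT => t0.
  rewrite ger0_norm ?mulr_ge0 ?exprn_ge0 ?expR_ge0//.
  have /andP[_] := moment_expR_le j x2 t0; apply: le_trans.
  by rewrite ler_wpM2l ?exprn_ge0// ler_expR lerN2 ler_wpM2r// ltW.
have intf y : `](x / 2), (x + 1)[%classic y -> pos.-integrable `[0%R, +oo[ (EFin \o f y).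
  move=> Iy; apply: sm_pos_integrable (bnd k y Iy); first exact: measurable_itv.
  exact: measurable_moment.
have derf y t : `](x / 2), (x + 1)[%classic y -> `[0%R, +oo[%classic t ->
    derivable (f ^~ t) y 1 by move=> _ _; exact: ex_derive.
have G0 t : 0 <= G t by rewrite exprn_ge0// divr_ge0// ltW.
have intG : pos.-integrable `[0%R, +oo[ (EFin \o G).
  by apply: finite_measure_integrable_cst; exact: measurable_itv.
have d1 y t : partial1of2 f y t = - (t ^+ k.+1 * expR (- (y * t))).
  by rewrite partial1of2E; apply: derive_val.
have G_ub y t : `](x / 2), (x + 1)[%classic y -> `[0%R, +oo[%classic t ->
    `|partial1of2 f y t| <= G t.
  by move=> Iy It; rewrite d1 normrN; exact: bnd.
have mI : measurable (`[0%R, +oo[%classic : set (measurableTypeR R)).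
  exact: measurable_itv.
have D := derivable_under_integral mI Ix intf derf G0 intG G_ub.
have E := differentiation_under_integral mI Ix intf derf G0 intG G_ub.
apply: DeriveDef; first exact: D.
rewrite -derive1E E /laplace_moment -mulN1r -RintegralZl//; last first.
  apply: sm_pos_integrable (bnd k.+1 x Ix) => //; exact: measurable_moment.
by apply: eq_Rintegral => t _; rewrite d1 mulN1r.
Qed.

Lemma alternating_laplace_moment n k : alternating n (laplace_moment k).
Proof.
elim: n k => [|n IH] k; first by split => // x _; exact: laplace_moment_ge0.
split; first by move=> x _; exact: laplace_moment_ge0.
by exists (laplace_moment k.+1); split => // x x0; exact: is_derive_laplace_moment.
Qed.

End CompleteMonotonicity.

Section PositiveDenominator.
Context {R : realType} (phi : signed_measure R).
Local Notation pos := (sm_pos phi).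
Local Notation neg := (sm_neg phi).
Local Notation H := (shifted_laplace phi).
Let n : R := fine (neg `[0%R, +oo[%classic).
Let m : R := fine (pos `[0%R, +oo[%classic).

Let mI : measurable (`[0%R, +oo[%classic : set (measurableTypeR R)).
Proof. exact: measurable_itv. Qed.

Lemma shifted_laplace0 : H 0 = n - m.
Proof.
rewrite /shifted_laplace add0r; congr (_ - _).
under eq_Rintegral do rewrite mul0r oppr0 expR0.
by rewrite Rintegral_cst// mul1r.
Qed.

Lemma integrable_expRN_pos x : 0 <= x ->
  pos.-integrable `[0%R, +oo[ (EFin \o (fun t => expR (- (x * t)))).
Proof.
move=> x0; apply: (@sm_pos_integrable _ _ _ 1) => //.
  by apply: derivable_measurableR => t; exact: ex_derive.
move=> t; rewrite /= in_itv/= andbT => t0.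
by rewrite ger0_norm ?expR_ge0// -expR0 ler_expR oppr_le0 mulr_ge0.
Qed.

Lemma shifted_laplace_ge x : 0 <= x -> x + n - m <= H x.
Proof.
move=> x0; rewrite /shifted_laplace lerD2l lerN2.
rewrite -[leRHS]mul1r -Rintegral_cst//; apply: le_Rintegral => //.
- exact: integrable_expRN_pos.
- exact: finite_measure_integrable_cst.
- move=> t; rewrite /= in_itv/= andbT => t0.
  by rewrite -expR0 ler_expR oppr_le0 mulr_ge0.
Qed.

(** With the absolute value the integrand is bounded by 1 also to the left of
0, so that dominated convergence applies on a neighbourhood of 0. *)
Lemma continuous_shifted_laplace_norm : continuous (fun x : R => H `|x|).
Proof.
have cf (t : R) : continuous (fun x : R => expR (- (`|x| * t))).
  move=> x; apply: (@continuous_comp _ _ _ (fun x : R => `|x|) (fun y => expR (- (y * t)))).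
    exact: norm_continuous.
  by apply: derivable_continuousR => y; exact: ex_derive.
move=> x.
apply: cvgB; first by apply: cvgD; [exact: norm_continuous|exact: cvg_cst].
have xI : x \in `](x - 1), (x + 1)[%classic.
  by rewrite inE/= in_itv/=; apply/andP; split; lra.
apply: (@continuity_under_integral _ _ _ pos (fun y t => expR (- (`|y| * t)))
  _ mI (x - 1) (x + 1) _ _ (cst 1) _ _ _ xI).
- by move=> y _; exact: integrable_expRN_pos.
- by apply: aeW => t _ y _; exact: cf.
- exact: finite_measure_integrable_cst.
- move=> y _; apply: aeW => t; rewrite /= in_itv/= andbT => t0.
  by rewrite ger0_norm ?expR_ge0// -expR0 ler_expR oppr_le0 mulr_ge0.
Qed.

Hypothesis phi_ge0 : forall B : set (measurableTypeR R), measurable B ->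
  (0 <= sm_val phi (B `&` `]0%R, +oo[%classic))%E.
Hypothesis h_neq0 : forall z : R[i], 0 <= complex.Re z -> h_fun phi z <> 0.

(** [shifted_laplace] is continuous, positive far out and, being h_phi, without
zeros on [0, +oo[. *)
Lemma shifted_laplace_gt0 x : 0 <= x -> 0 < H x.
Proof.
move=> x0; rewrite ltNge; apply/negP => Hx.
have n0 : 0 <= n by rewrite fine_ge0.
have m0 : 0 <= m by rewrite fine_ge0.
(* h_phi(y) >= y + n - m > 0 for y > m *)
pose b := x + m + 1.
have xb : x <= b by rewrite /b -addrA lerDl addr_ge0.
have b0 : 0 <= b := le_trans x0 xb.
have Hb : 0 <= H b by apply: le_trans (shifted_laplace_ge b0); rewrite /b; lra.
have : Num.min (H `|x|) (H `|b|) <= 0 <= Num.max (H `|x|) (H `|b|).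
  by rewrite !ger0_norm// ge_min le_max Hx Hb orbT.
move=> /(IVT xb (continuous_subspaceT continuous_shifted_laplace_norm))[c].
rewrite in_itv/= => /andP[xc _]; have c0 := le_trans x0 xc.
rewrite ger0_norm// => Hc; apply: (@h_neq0 c%:C) => //.
by rewrite h_fun_laplace// Hc.
Qed.

(** The value of h_phi at 0 is the mass of the negative part minus the mass of
the positive part. *)
Lemma pos_lt_neg : m < n.
Proof. by rewrite -subr_gt0 -shifted_laplace0; exact: shifted_laplace_gt0. Qed.

Lemma is_derive_shifted_laplace (x : R) : 0 < x ->
  is_derive x 1 H (1 + laplace_moment phi 1 x).
Proof.
move=> x0.
have d0 := is_derive_laplace_moment phi 0 x0.
rewrite (_ : H = (fun x => x + n - laplace_moment phi 0 x)).
  by apply: is_derive_eq; rewrite addr0 opprK.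
apply/funext => y; rewrite /shifted_laplace/laplace_moment; congr (_ - _).
by apply: eq_Rintegral => t _; rewrite expr0 mul1r.
Qed.

Lemma inverse_h_completely_monotone :
  completely_monotone (fun x : R => complex.Re (1 / h_fun phi x%:C)).
Proof.
rewrite (_ : (fun x : R => _) = (fun x => (H x)^-1)); last first.
  apply/funext => x; rewrite h_fun_laplace// mul1r.
  by rewrite -(fmorphV (real_complex R)).
apply: alternating_completely_monotone.
apply: (@alternating_riccati _ _ (fun x => 1 + laplace_moment phi 1 x)).
- by move=> x x0; rewrite invr_ge0 ltW// shifted_laplace_gt0// ltW.
- move=> x x0; have Hx : H x != 0 by rewrite gt_eqF// shifted_laplace_gt0// ltW.
  have d := is_derive_shifted_laplace x0.
  apply: is_derive_eq (is_deriveV Hx d) _.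
  rewrite /GRing.scale /=; field => //.
- move=> k; apply: alternatingD; first exact: alternating_cst.
  exact: alternating_laplace_moment.
Qed.

End PositiveDenominator.

(** * Nonnegativity of g_phi *)

Section Nonnegativity.
Context {R : realType} (phi : signed_measure R) (g : R -> R).
Local Notation pos := (sm_pos phi).
Local Notation neg := (sm_neg phi).
Local Notation mu := (@lebesgue_measure R).
Hypothesis phi_ge0 : forall B : set (measurableTypeR R), measurable B ->
  (0 <= sm_val phi (B `&` `]0%R, +oo[%classic))%E.
Hypothesis h_neq0 : forall z : R[i], 0 <= complex.Re z -> h_fun phi z <> 0.
Hypothesis g_phi : is_g_fun phi g.

Let n : R := fine (neg `[0%R, +oo[%classic).
Let m : R := fine (pos `[0%R, +oo[%classic).
Let G : R -> R := g \_ `[0%R, +oo[.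
Let e : R -> R := (fun t => expR (- (n * t))) \_ `[0%R, +oo[.
Let k : R -> R := \1_(`[0%R, +oo[%classic : set R).

Let m0 : 0 <= m. Proof. by rewrite fine_ge0. Qed.
Let mn : m < n. Proof. exact: pos_lt_neg. Qed.
Let n0 : 0 < n. Proof. exact: le_lt_trans mn. Qed.

Let Gi : mu.-integrable setT (EFin \o G).
Proof.
rewrite /G -restrict_EFin; apply/integrable_restrict => //; rewrite setTI.
exact: g_phi.1.
Qed.

Let ei : mu.-integrable setT (EFin \o e).
Proof.
rewrite /e -restrict_EFin; apply/integrable_restrict => //; rewrite setTI.
exact: integrable_expRN.
Qed.

Let e0 t : 0 <= e t.
Proof. by rewrite /e patchE; case: ifP => // _; exact: expR_ge0. Qed.

Let ki : pos.-integrable setT (EFin \o k).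
Proof.
apply: (@sm_pos_integrable _ _ _ 1) => //; first exact: measurable_indic.
by move=> t _; rewrite /k indicE; case: (_ \in _); rewrite ?normr1 ?normr0.
Qed.

Let k0 t : 0 <= k t.
Proof. by rewrite /k indicE. Qed.

Let half_line d (X : measurableType d) (mu' : {measure set X -> \bar R})
    (D : set X) (u v : X -> R) :
  \int[mu']_t ((u \_ D) t * v t) = \int[mu']_(t in D) (u t * v t).
Proof.
rewrite [RHS]Rintegral_mkcond; apply: eq_Rintegral => t _.
by rewrite !patchE; case: ifP; rewrite ?mul0r.
Qed.

Let k_half_line (v : R -> R) :
  \int[pos]_t (k t * v t) = \int[pos]_(t in `[0%R, +oo[) v t.
Proof.
rewrite [RHS]Rintegral_mkcond; apply: eq_Rintegral => t _.
by rewrite /k indicE patchE; case: ifP; rewrite ?mul1r ?mul0r.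
Qed.

Let e_cos y : \int[mu]_t (e t * cos (t * y)) = n / (n ^+ 2 + y ^+ 2).
Proof.
rewrite half_line -Rintegral_expRNcos//.
by apply: eq_Rintegral => t _; rewrite (mulrC t).
Qed.

Let e_sin y : \int[mu]_t (e t * sin (t * y)) = y / (n ^+ 2 + y ^+ 2).
Proof.
rewrite half_line -Rintegral_expRNsin//.
by apply: eq_Rintegral => t _; rewrite (mulrC t).
Qed.

Let C y := \int[mu]_t (G t * cos (t * y)).
Let S y := \int[mu]_t (G t * sin (t * y)).
Let pc y := \int[pos]_(t in `[0%R, +oo[) cos (t * y).
Let ps y := \int[pos]_(t in `[0%R, +oo[) sin (t * y).

(** Since h_phi(iy) is not 0, its product with the Fourier transform of g_phi is
1; the two equations are the real and the imaginary part of this. *)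
Lemma g_fourier y :
  (n - pc y) * C y + (y + ps y) * S y = 1 /\
  (y + ps y) * C y - (n - pc y) * S y = 0.
Proof.
have E : C y +i* (- S y) = 1 / h_fun phi (0 +i* y).
  rewrite -g_phi.2 /cintegral; congr (_ +i* _).
    rewrite /C half_line; apply: eq_Rintegral => t _.
    rewrite /cexp /= !(mulr0, mul0r, oppr0, addr0, subr0, add0r, expR0, mul1r).
    by rewrite cosN mulrC.
  rewrite /S half_line -mulN1r -RintegralZl//.
    apply: eq_Rintegral => t _.
    rewrite /cexp /= !(mulr0, mul0r, oppr0, addr0, subr0, add0r, expR0, mul1r).
    by rewrite sinN; ring.
  apply: integrable_bounded_mul => //; first exact: g_phi.1.
    by apply: measurable_funTS; apply: derivable_measurableR => t; exact: ex_derive.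
  by move=> t; exact: normr_sin_le1.
have h0 : h_fun phi (0 +i* y) <> 0 by exact: h_neq0.
have := congr1 (fun z => z * h_fun phi (0 +i* y)) E.
rewrite mul1r mulVf; last exact/eqP.
rewrite h_fun_imaginary// -/n -/(pc y) -/(ps y) => /eqP.
rewrite eq_complex/= => /andP[/eqP <- /eqP <-]; split; ring.
Qed.

Let W := convolution pos k G.
Let V := convolution mu e W.

Let Wi : mu.-integrable setT (EFin \o W).
Proof. exact: integrable_convolution. Qed.

Let Vi : mu.-integrable setT (EFin \o V).
Proof. exact: integrable_convolution. Qed.

(** In the notation of Fourier transforms, (iy + n - pos^) G^ = 1 reads
G^ = (1 + pos^ G^) / (n + iy), and 1 / (n + iy) is the transform of [e]. *)
Lemma renewal_equation : {ae mu, forall t, G t - (e t + V t) = 0}.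
Proof.
have d0 y : n ^+ 2 + y ^+ 2 != 0.
  by rewrite gt_eqF// ltr_pwDl ?sqr_ge0// exprn_gt0.
have Wc y : \int[mu]_t (W t * cos (t * y)) = n * C y + y * S y - 1.
  rewrite (Rintegral_convolution_cos k0 ki Gi) !k_half_line -/(C y) -/(S y) -/(pc y) -/(ps y).
  by have [<- _] := g_fourier y; ring.
have Ws y : \int[mu]_t (W t * sin (t * y)) = n * S y - y * C y.
  rewrite (Rintegral_convolution_sin k0 ki Gi) !k_half_line -/(C y) -/(S y) -/(pc y) -/(ps y).
  by rewrite -[RHS]addr0; have [_ <-] := g_fourier y; ring.
have eVi : mu.-integrable setT (EFin \o (fun t => e t + V t)).
  exact: (integrableD measurableT ei Vi).
have ri : mu.-integrable setT (EFin \o (fun t => G t - (e t + V t))).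
  exact: (integrableB measurableT Gi eVi).
have lin (psi : R -> R) : measurable_fun setT psi -> (forall t, `|psi t| <= 1) ->
    \int[mu]_t ((G t - (e t + V t)) * psi t) =
    \int[mu]_t (G t * psi t) - (\int[mu]_t (e t * psi t) + \int[mu]_t (V t * psi t)).
  move=> mpsi psi1.
  have i1 := integrable_bounded_mul measurableT Gi mpsi psi1.
  have i2 := integrable_bounded_mul measurableT ei mpsi psi1.
  have i3 := integrable_bounded_mul measurableT Vi mpsi psi1.
  rewrite -RintegralD// -RintegralB//; last exact: (integrableD measurableT i2 i3).
  by apply: eq_Rintegral => t _; ring.
apply: (fourier_uniqueness ri) => y.
  rewrite lin; last by move=> t; exact: normr_cos_le1.
    rewrite (Rintegral_convolution_cos e0 ei Wi) Wc Ws e_cos e_sin -/(C y).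
    by field.
  by apply: derivable_measurableR => t; exact: ex_derive.
rewrite lin; last by move=> t; exact: normr_sin_le1.
  rewrite (Rintegral_convolution_sin e0 ei Wi) Wc Ws e_cos e_sin -/(S y).
  by field.
by apply: derivable_measurableR => t; exact: ex_derive.
Qed.

Let int_e : \int[mu]_t e t = n^-1.
Proof. by rewrite /e -Rintegral_mkcond /Rintegral integral_expRN. Qed.

Let int_k : \int[pos]_t k t = m.
Proof.
rewrite (_ : k = fun t => k t * 1); last by apply/funext => t; rewrite mulr1.
by rewrite k_half_line Rintegral_cst// mul1r.
Qed.

(** The renewal equation gives |G| <= 1/n + (m/n) |G| for the L1 norm, that is
|G| <= 1 / (n - m); the bound is 1/h_phi(0), the integral of [G]. *)
Lemma g_norm_le : \int[mu]_t `|G t| <= \int[mu]_t G t.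
Proof.
have absi f : mu.-integrable setT (EFin \o f) ->
    mu.-integrable setT (EFin \o (fun t => `|f t|)) by exact: integrable_abse.
have eVi : mu.-integrable setT (EFin \o (fun t => e t + V t)).
  exact: (integrableD measurableT ei Vi).
set N := \int[mu]_t `|G t|.
have N1 : N <= n^-1 + N * m * n^-1.
  have NE : N = \int[mu]_t `|e t + V t|.
    rewrite /N /Rintegral; congr fine; apply: ae_eq_integral => //.
    - exact: (measurable_int mu (absi _ Gi)).
    - exact: (measurable_int mu (absi _ eVi)).
    - have := renewal_equation.
      by apply: (@filterS _ _ (ae_filter_ringOfSetsType mu)) => t /subr0_eq ->.
  rewrite [leLHS]NE; apply: (@le_trans _ _ (\int[mu]_t (e t + `|V t|))).
    apply: le_Rintegral => //; first exact: absi.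
      exact: (integrableD measurableT ei (absi _ Vi)).
    by move=> t _; rewrite (le_trans (ler_normD _ _))// (ger0_norm (e0 t)).
  rewrite RintegralD//; last exact: absi.
  rewrite int_e lerD2l (le_trans (norm_convolution_le e0 ei Wi))// int_e.
  by rewrite ler_wpM2r ?invr_ge0 ?(ltW n0)// -int_k; exact: (norm_convolution_le k0 ki Gi).
have N2 : N <= (n - m)^-1.
  rewrite -[leRHS]mul1r ler_pdivlMr ?subr_gt0//.
  have := ler_wpM2l (ltW n0) N1.
  have -> : n * (n^-1 + N * m * n^-1) = 1 + N * m by field; rewrite gt_eqF.
  by rewrite mulrBr (mulrC n N); lra.
rewrite (le_trans N2)// le_eqVlt; apply/orP; left; apply/eqP.
have [+ _] := g_fourier 0.
have -> : pc 0 = m.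
  rewrite /pc; under eq_Rintegral do rewrite mulr0 cos0.
  by rewrite Rintegral_cst// mul1r.
have -> : ps 0 = 0.
  rewrite /ps; under eq_Rintegral do rewrite mulr0 sin0.
  by rewrite Rintegral_cst// mul0r.
have -> : C 0 = \int[mu]_t G t.
  by apply: eq_Rintegral => t _; rewrite mulr0 cos0 mulr1.
rewrite addr0 mul0r addr0 => E.
by apply: (mulfI (x := n - m)); rewrite ?E ?mulfV// gt_eqF// subr_gt0.
Qed.

Lemma g_ge0 : {ae mu, forall t : R, 0 <= t -> 0 <= g t}.
Proof.
have Gabs : mu.-integrable setT (EFin \o (fun t => `|G t|)).
  exact: (integrable_abse Gi).
have Di : mu.-integrable setT (EFin \o (fun t => `|G t| - G t)).
  exact: (integrableB measurableT Gabs Gi).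
have D0 t : 0 <= `|G t| - G t by rewrite subr_ge0 ler_norm.
have : (\int[mu]_t `|(`|G t| - G t)%:E| = 0)%E.
  transitivity (\int[mu]_t (`|G t| - G t)%:E)%E.
    by apply: eq_integral => t _; rewrite gee0_abs// lee_fin.
  rewrite -[LHS]fineK; last exact: integrable_fin_num Di.
  congr EFin; rewrite -[LHS]/(\int[mu]_t (`|G t| - G t)) RintegralB//.
  apply/eqP; rewrite eq_le subr_le0 g_norm_le/= subr_ge0.
  by apply: le_Rintegral => // t _; exact: ler_norm.
move=> /(ae_eq_integral_abs mu measurableT (measurable_int mu Di)).
apply: (@filterS _ _ (ae_filter_ringOfSetsType mu)) => t /(_ I) [] /eqP.
rewrite subr_eq0 => /eqP E t0.
have <- : G t = g t by rewrite /G patchE ifT// inE/= in_itv/= t0.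
by rewrite -E.
Qed.

End Nonnegativity.

(** * Mean increments of subordinators *)

Section SubordinatorMean.
Context {R : realType} {d : measure_display} {T : measurableType d}.
Variable P : probability T R.
Variable nu : {measure set (measurableTypeR R) -> \bar R}.
Hypothesis nu_moment : (\int[nu]_(x in `[1%R, +oo[) x%:E < +oo)%E.

(** Small jumps are controlled by the integral of min(1, x), large ones by the
moment hypothesis. *)
Lemma levy_integrable_id :
  (\int[nu]_(x in `]0%R, +oo[) (Num.min 1 x)%:E < +oo)%E ->
  nu.-integrable `]0%R, +oo[ (EFin \o id).
Proof.
move=> nu_min; have mid : measurable_fun setT (EFin \o (id : R -> R)).
  exact/measurable_EFinP.
have mI (i : interval R) : measurable ([set` i] : set (measurableTypeR R)).
  exact: measurable_itv.
have U : (`]0%R, +oo[%classic : set (measurableTypeR R)) = `]0%R, 1%R[ `|` `[1%R, +oo[.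
  apply/seteqP; split => x /=; rewrite !in_itv/= !andbT.
    by move=> x0; have [x1|x1] := ltP x 1; [left; rewrite x0|right].
  by move=> [/andP[]//|]; exact: lt_le_trans.
apply/integrableP; split; first exact: (measurable_funTS mid).
have -> : (\int[nu]_(x in `]0%R, +oo[) `|(EFin \o id) x| =
    \int[nu]_(x in `]0%R, +oo[) x%:E)%E.
  apply: eq_integral => x; rewrite inE/= in_itv/= andbT => x0.
  by rewrite ger0_norm// ltW.
rewrite [in X in (integral _ X _)]U ge0_integral_setU//=; last 2 first.
- move=> x; rewrite !in_itv/= !andbT lee_fin => -[/andP[/ltW//]|].
  exact: le_trans.
- apply/disj_setPS => x [] /=; rewrite !in_itv/= andbT => /andP[_ x1] x1'.
  by have := lt_le_trans x1 x1'; rewrite ltxx.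
apply: lte_add_pinfty => //; apply: le_lt_trans nu_min.
apply: (@le_trans _ _ (\int[nu]_(x in `]0%R, 1%R[) (Num.min 1 x)%:E)%E).
  rewrite le_eqVlt; apply/orP; left; apply/eqP; apply: eq_integral => x.
  by rewrite inE/= in_itv/= => /andP[_ x1]; rewrite minEle leNgt x1.
apply: ge0_subset_integral => //.
- apply/measurable_EFinP; apply: measurable_funTS; exact: measurable_minr.
- move=> x; rewrite /= in_itv/= andbT lee_fin le_min ler01 /=; exact: ltW.
- by move=> x /=; rewrite !in_itv/= andbT => /andP[].
Qed.

Lemma levy_exponent_le (u : R) : 0 <= u ->
  nu.-integrable `]0%R, +oo[ (EFin \o id) ->
  \int[nu]_(x in `]0%R, +oo[) (1 - expR (- u * x)) <=
  u * \int[nu]_(x in `]0%R, +oo[) x.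
Proof.
move=> u0 idi.
have mI : measurable (`]0%R, +oo[%classic : set (measurableTypeR R)).
  exact: measurable_itv.
have ui : nu.-integrable `]0%R, +oo[ (EFin \o (fun x => u * x)).
  exact: (integrableZl mI u idi).
have le1 (x : R) : 0 < x -> 0 <= 1 - expR (- u * x) <= u * x.
  move=> x0; rewrite subr_ge0 -expR0 ler_expR mulNr oppr_le0 mulr_ge0 ?(ltW x0)//=.
  by have := expR_ge1Dx (- (u * x)); rewrite expR0; lra.
rewrite -RintegralZl//; apply: le_Rintegral => //.
  apply: (le_integrable mI _ _ ui).
    apply/measurable_EFinP; apply: measurable_funTS.
    by apply: derivable_measurableR => t; exact: ex_derive.
  move=> x /=; rewrite in_itv/= andbT => /le1 /andP[h1 h2].
  by rewrite lee_fin !ger0_norm// (le_trans h1).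
by move=> x /=; rewrite in_itv/= andbT => /le1 /andP[].
Qed.

(** From u X / (1 + u X) <= 1 - exp(-uX) and 1 - exp(-cu) <= cu, the mean of
X / (1 + u X) is at most c; let u decrease to 0 by monotone convergence. *)
Lemma mean_le_laplace (X : T -> R) (c : R) : measurable_fun setT X ->
  (forall w, 0 <= X w) ->
  (forall u, 0 < u -> expR (- (c * u)) <= \int[P]_w expR (- (u * X w))) ->
  (\int[P]_w (X w)%:E <= c%:E)%E.
Proof.
move=> mX X0 lap.
pose u (n : nat) : R := n.+1%:R^-1.
have u0 n : 0 < u n by rewrite invr_gt0.
pose f n w : R := X w / (1 + u n * X w).
have den n w : 0 < 1 + u n * X w by rewrite ltr_wpDr// mulr_ge0// ltW.
have mf n : measurable_fun setT (EFin \o f n).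
  apply/measurable_EFinP; apply: measurable_funM => //.
  pose D (x : R) : R := (1 + u n * Num.max 0 x)^-1.
  rewrite (_ : (fun w => _) = D \o X); last first.
    by apply/funext => w; rewrite /D /= max_r.
  apply: measurableT_comp mX; apply: continuous_measurable_fun => x.
  rewrite /D; apply: cvgV.
    by rewrite gt_eqF// ltr_wpDr// mulr_ge0 ?(ltW (u0 n))// le_max lexx.
  apply: cvgD; first exact: cvg_cst.
  apply: cvgMr; apply: continuous_max; [exact: cvg_cst|exact: cvg_id].
have f0 n w : 0 <= f n w by rewrite divr_ge0// ltW.
have f_nd w : {homo (fun n => (f n w)%:E) : i j / (i <= j)%N >-> (i <= j)%E}.
  move=> i j ij; rewrite lee_fin ler_wpM2l// lef_pV2 ?posrE//.
  by rewrite lerD2l ler_wpM2r// lef_pV2 ?posrE// ler_nat ltnS.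
have ef n : (\int[P]_w (f n w)%:E <= c%:E)%E.
  have ei : P.-integrable setT (EFin \o (fun w => expR (- (u n * X w)))).
    apply: (le_integrable measurableT _ _
      (finite_measure_integrable_cst P 1 measurableT)).
      apply/measurable_EFinP; apply: measurableT_comp => //.
      by apply: measurable_funN; exact: measurable_funM.
    move=> w _ /=; rewrite lee_fin normr1 ger0_norm ?expR_ge0//.
    by rewrite -expR0 ler_expR oppr_le0 mulr_ge0// ltW.
  have ci : P.-integrable setT (EFin \o cst (1 : R)).
    exact: finite_measure_integrable_cst.
  have gi : P.-integrable setT (EFin \o (fun w => 1 - expR (- (u n * X w)))).
    exact: (integrableB measurableT ci ei).
  apply: (@le_trans _ _ (\int[P]_w (n.+1%:R * (1 - expR (- (u n * X w))))%:E)%E).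
    apply: ge0_le_integral => //.
    - by move=> w _; rewrite lee_fin.
    - exact: mf.
    - exact: (measurable_int P (integrableZl measurableT n.+1%:R gi)).
    - move=> w _; rewrite lee_fin /f ler_pdivrMr//.
      have nu1 : n.+1%:R * u n = 1 by rewrite mulfV ?pnatr_eq0.
      have y0 : 0 <= u n * X w by rewrite mulr_ge0// ltW.
      have ey : expR (- (u n * X w)) * (1 + u n * X w) <= 1.
        by rewrite expRN mulrC ler_pdivrMr ?expR_gt0// mul1r expR_ge1Dx.
      have XE : X w = n.+1%:R * (u n * X w) by rewrite mulrA nu1 mul1r.
      rewrite [leLHS]XE -mulrA ler_wpM2l//; lra.
  rewrite -[leLHS]fineK; last first.
    exact: (integrable_fin_num measurableT (integrableZl measurableT n.+1%:R gi)).
  rewrite lee_fin -[leLHS]/(\int[P]_w (n.+1%:R * (1 - expR (- (u n * X w))))).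
  rewrite RintegralZl// RintegralB// Rintegral_cst//.
  have -> : fine (P setT) = 1 by rewrite probability_setT.
  rewrite mul1r.
  have := lap _ (u0 n); have := expR_ge1Dx (- (c * u n)).
  have nu1 : n.+1%:R * u n = 1 by rewrite mulfV ?pnatr_eq0.
  move=> h1 h2.
  have -> : c = n.+1%:R * (c * u n) by rewrite mulrCA nu1 mulr1.
  rewrite ler_wpM2l//; lra.
have cvf w : f n w @[n --> \oo] --> X w.
  rewrite -[X in _ --> X]divr1 -[X in _ / X](addr0 1) -[X in 1 + X](mul0r (X w)).
  apply: cvgM; first exact: cvg_cst.
  apply: cvgV; first by rewrite mul0r addr0 oner_eq0.
  apply: cvgD; first exact: cvg_cst.
  by apply: cvgMl; exact: cvg_harmonic.
have -> : (\int[P]_w (X w)%:E = \int[P]_w (limn (fun n => (f n w)%:E)))%E.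
  apply: eq_integral => w _; apply/esym/cvg_lim; first exact: ereal_hausdorff.
  by apply: cvg_EFin; [exact: nearW|exact: cvf].
rewrite monotone_convergence//; last first.
  by move=> n w _; rewrite lee_fin.
apply: lime_le; last by apply: nearW => n; exact: ef.
apply: ereal_nondecreasing_is_cvgn => i j ij; apply: ge0_le_integral => //.
- by move=> w _; rewrite lee_fin.
- exact: mf.
- exact: mf.
- by move=> w _; exact: f_nd.
Qed.

End SubordinatorMean.

Section SubordinatorPaths.
Context {R : realType} {d : measure_display} {T : measurableType d}.
Variable P : probability T R.
Variable nu : {measure set (measurableTypeR R) -> \bar R}.

Section OneSided.
Variable L : R -> {RV P >-> R}.
Hypothesis subL : subordinator P nu (fun t => L t).

Let mL t : measurable_fun setT (L t).
Proof. exact: measurable_funPT. Qed.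

Lemma subordinator_ge0 t : 0 <= t -> {ae P, forall w, 0 <= L t w}.
Proof.
have [[L0 _ incr _ _] _] := subL => t0.
by apply: filterS2 L0 (incr 0 t (lexx 0) t0) => w ->; rewrite subr0.
Qed.

Lemma integral_increment (s h : R) : 0 <= s -> 0 <= h ->
  (\int[P]_w (Num.max 0 (L (s + h) w - L s w))%:E =
   \int[P]_w (Num.max 0 (L h w))%:E)%E.
Proof.
move=> s0 h0; have [[L0 _ _ stat _] _] := subL.
have mmax : measurable_fun setT (fun x : R => (Num.max 0 x)%:E).
  by apply/measurable_EFinP; exact: measurable_maxr.
have max0 (x : R) : (0 <= (Num.max 0 x)%:E)%E by rewrite lee_fin le_max lexx.
have m1 : measurable_fun setT (L (s + h) \- L s) by apply: measurable_funB.
have m2 : measurable_fun setT (L h \- L 0) by apply: measurable_funB.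
have := ge0_integral_pushforward m1 P measurableT mmax (fun y _ => max0 y).
rewrite preimage_setT /= => <-.
transitivity (\int[pushforward P (L h \- L 0)%R]_y (Num.max 0 y)%:E)%E.
  by apply: eq_measure_integral => B mB _; exact: stat.
rewrite (ge0_integral_pushforward m2 P measurableT mmax (fun y _ => max0 y)).
rewrite preimage_setT /=; apply: ae_eq_integral => //.
- by apply: (measurableT_comp mmax m2).
- by apply: (measurableT_comp mmax).
- by apply: filterS L0 => w /= -> _; rewrite subr0.
Qed.

Hypothesis nu_moment : (\int[nu]_(x in `[1%R, +oo[) x%:E < +oo)%E.

Lemma subordinator_increment_mean : exists2 C : R, 0 <= C &
  forall s t : R, 0 <= s -> s <= t ->
    (\int[P]_w (Num.max 0 (L t w - L s w))%:E <= (C * (t - s))%:E)%E.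
Proof.
have [_ [_ nu_min [b b0 lap]]] := subL.
have idi := levy_integrable_id nu_moment nu_min.
pose K := \int[nu]_(x in `]0%R, +oo[) x.
have K0 : 0 <= K.
  by apply: Rintegral_ge0 => x; rewrite /= in_itv/= andbT => /ltW.
exists (b + K) => [|s t s0 st]; first exact: addr_ge0.
have ts0 : 0 <= t - s by rewrite subr_ge0.
have -> : t = s + (t - s) by rewrite addrC subrK.
rewrite integral_increment// (addrC s) addrK.
set h := t - s in ts0 *.
apply: mean_le_laplace => [|w|u u0].
- exact: measurable_maxr.
- by rewrite le_max lexx.
have -> : \int[P]_w expR (- (u * Num.max 0 (L h w))) =
    fine ('E_P[fun w => expR (- u * L h w)])%E.
  rewrite unlock /Rintegral; congr fine; apply: ae_eq_integral => //.
  - apply/measurable_EFinP; apply: measurableT_comp => //.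
    apply: measurable_funN; apply: measurable_funM => //; exact: measurable_maxr.
  - apply/measurable_EFinP; apply: measurableT_comp => //; exact: measurable_funM.
  - apply: filterS (subordinator_ge0 ts0) => w Lh0 _.
    by rewrite max_r// mulNr.
rewrite lap ?(ltW u0)//= ler_expR mulNr lerN2.
rewrite (_ : (b + K) * h * u = h * (b * u + u * K)); last by ring.
by rewrite ler_wpM2l// lerD2l; apply: levy_exponent_le => //; exact: ltW.
Qed.

(** Monotonicity is only known almost surely for each pair of times; it is used
along a sequence of times that increases to [s]. *)
Lemma subordinator_left_limit (r s : R) : 0 <= r -> r < s ->
  {ae P, forall w, L r w <= lim (L u w @[u --> s^'-]) <= L s w}.
Proof.
move=> r0 rs; have [[_ cad incr _ _] _] := subL.
pose u (n : nat) : R := s - (s - r) / n.+2%:R.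
have sr0 : 0 < s - r by rewrite subr_gt0.
have us n : u n < s by rewrite ltrBlDr ltrDl divr_gt0.
have ru n : r <= u n.
  by rewrite lerBrDr -lerBrDl ler_pdivrMr// ler_peMr ?(ltW sr0)// ler1n.
have cu : u n @[n --> \oo] --> s.
  rewrite -[X in _ --> X]subr0 -(mulr0 (s - r)).
  apply: cvgB; first exact: cvg_cst.
  apply: cvgMr.
  by rewrite (cvg_shiftS (fun n : nat => n.+1%:R^-1 : R)); exact: cvg_harmonic.
have s0 : 0 < s := le_lt_trans r0 rs.
have up n := incr r (u n) r0 (ru n).
have down n := incr (u n) s (le_trans r0 (ru n)) (ltW (us n)).
have {}up := ae_foralln up; have {}down := ae_foralln down.
apply: filterS3 cad up down => w [_ /(_ s s0) cadw] upw downw.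
have cl : L (u n) w @[n --> \oo] --> lim (L u w @[u --> s^'-]).
  by move/cvg_at_leftP : cadw; apply.
rewrite -(cvg_lim (@Rhausdorff R) cl).
have is_c : cvgn (fun n => L (u n) w) by apply/cvg_ex; eexists; exact: cl.
apply/andP; split.
- by apply: limr_ge => //; apply: nearW => n; rewrite -subr_ge0.
- by apply: limr_le => //; apply: nearW => n; rewrite -subr_ge0.
Qed.

End OneSided.

(** A majorant with small mean replaces the increment itself, which involves
left limits at negative times: these are bounded by values of [L2] at nearby
times, and the room [eps] pays for moving the time. *)
Lemma two_sided_increment_mean (L : R -> T -> R) :
  two_sided_subordinator P nu L ->
  (\int[nu]_(x in `[1%R, +oo[) x%:E < +oo)%E ->
  exists2 C : R, 0 <= C & forall a b eps : R, a <= b -> 0 < eps ->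
    exists Y : T -> R, [/\ measurable_fun setT Y, forall w, 0 <= Y w,
      (\int[P]_w (Y w)%:E <= (C * (b - a) + eps)%:E)%E &
      {ae P, forall w, L b w - L a w <= Y w}].
Proof.
move=> [L1 [L2 [sub1 sub2 _ _ LE]]] nu_moment.
have [C1 C10 inc1] := subordinator_increment_mean sub1 nu_moment.
have [C2 C20 inc2] := subordinator_increment_mean sub2 nu_moment.
exists (C1 + C2) => [|a b eps ab eps0]; first exact: addr_ge0.
have mY (K : R -> {RV P >-> R}) s t :
    measurable_fun setT (fun w => Num.max 0 (K t w - K s w)).
  by apply: measurable_maxr => //; exact: measurable_funB.
have Y0 (x : R) : 0 <= Num.max 0 x by rewrite le_max lexx.
have Yge (x : R) : x <= Num.max 0 x by rewrite le_max lexx orbT.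
have [a0|a0] := leP 0 a.
  exists (fun w => Num.max 0 (L1 b w - L1 a w)); split => //.
    apply: le_trans (inc1 _ _ a0 ab) _; rewrite lee_fin.
    by rewrite mulrDl -addrA lerDl addr_ge0 ?mulr_ge0 ?subr_ge0// ltW.
  by apply: aeW => w; rewrite !LE a0 (le_trans a0 ab).
have na0 : 0 < - a by rewrite oppr_gt0.
have [b0|b0] := leP 0 b.
  exists (fun w => Num.max 0 (L1 b w - L1 0 w) + Num.max 0 (L2 (- a) w - L2 0 w)).
  split.
  - exact: measurable_funD.
  - by move=> w; rewrite addr_ge0.
  - under eq_integral do rewrite EFinD.
    rewrite ge0_integralD//; try exact/measurable_EFinP;
      try by move=> w _; rewrite lee_fin.
    apply: (@le_trans _ _ ((C1 * (b - 0))%:E + (C2 * (- a - 0))%:E)%E).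
      by apply: leeD; [exact: inc1|apply: inc2 => //; exact: ltW].
    rewrite -EFinD lee_fin !subr0 mulrDl !mulrBr.
    have : 0 <= C1 * - a by rewrite mulr_ge0// ltW.
    have : 0 <= C2 * b by rewrite mulr_ge0.
    by rewrite !mulrN; lra.
  - have [[z1 _ _ _ _] _] := sub1; have [[z2 _ _ _ _] _] := sub2.
    have la := subordinator_left_limit sub2 (lexx 0) na0.
    apply: filterS3 z1 z2 la => w z1w z2w /andP[_ lim_le].
    rewrite !LE b0 (leNgt 0 a) a0/= opprK z1w z2w !subr0.
    by apply: lerD; [exact: Yge|exact: le_trans (Yge _)].
pose C := C1 + C2; have C0 : 0 <= C by exact: addr_ge0.
pose del := Num.min (- b) (eps / (C + 1)).
have del0 : 0 < del.
  by rewrite lt_min oppr_gt0 b0/= divr_gt0// ltr_wpDl.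
have r0 : 0 <= - b - del by rewrite subr_ge0 ge_min lexx.
have rb : - b - del < - b by rewrite ltrBlDr ltrDl.
have ra : - b - del <= - a by rewrite (le_trans (ltW rb))// lerN2.
exists (fun w => Num.max 0 (L2 (- a) w - L2 (- b - del) w)); split => //.
  apply: le_trans (inc2 _ _ r0 ra) _; rewrite lee_fin.
  have : C2 * del <= eps.
    apply: (@le_trans _ _ ((C + 1) * (eps / (C + 1)))).
      apply: ler_pM => //; [exact: ltW| |by rewrite ge_min lexx orbT].
      by rewrite /C; lra.
    by rewrite mulrC divfK// gt_eqF// ltr_wpDl.
  have : 0 <= C1 * (b - a) by rewrite mulr_ge0 ?subr_ge0.
  by move=> *; rewrite mulrDl; lra.
have la := subordinator_left_limit sub2 (lexx 0) na0.
have lb := subordinator_left_limit sub2 r0 rb.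
apply: filterS2 la lb => w /andP[_ la] /andP[lb _].
rewrite !LE (leNgt 0 b) b0 (leNgt 0 a) a0/= opprK addrC; apply: le_trans (Yge _).
exact: lerB.
Qed.

End SubordinatorPaths.

(** * Null sets and the moving average *)

Section NullSets.
Context {R : realType}.
Local Notation mu := (@lebesgue_measure R).

Lemma lebesgue_measure_reflect (t : R) (A : set (measurableTypeR R)) :
  measurable A -> mu ((fun u : R => t - u) @^-1` A) = mu A.
Proof.
have mT : measurable_fun setT (fun u : measurableTypeR R => (t - u : measurableTypeR R)).
  by apply: measurable_funB.
move=> mA; symmetry.
rewrite -[RHS]/(pushforward mu (fun u : measurableTypeR R => (t - u : measurableTypeR R)) A).
apply: lebesgue_measure_unique => // X [[a b] _ <-].
rewrite /= /pushforward lebesgue_measure_itv/=.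
rewrite (_ : _ @^-1` _ = `[t - b, t - a[%classic); last first.
  apply/seteqP; split => x; rewrite /= !in_itv/=.
    by move=> /andP[h1 h2]; apply/andP; split; lra.
  by move=> /andP[h1 h2]; apply/andP; split; lra.
rewrite lebesgue_measure_itv/= !lte_fin ltrD2l ltrN2 -!EFinB.
by congr (if _ then _%:E else _); ring.
Qed.

(** The maximum accounts for functions that are not cumulative, for which
[stieltjes] is the zero measure. *)
Lemma stieltjes_itv_le (F : R -> R) (a b : R) : a <= b ->
  (stieltjes F `]a, b]%classic <= (Num.max 0 (F b - F a))%:E)%E.
Proof.
move=> ab; rewrite /stieltjes; case: pselect => [[ndF rcF]|_]; last first.
  by rewrite /mzero lee_fin le_max lexx.
rewrite /= /lebesgue_stieltjes_measure /= /measure_extension measurable_mu_extE/=; last first.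
  exact: is_ocitv.
by rewrite wlength_itv_bnd// lee_fin le_max lexx orbT.
Qed.

Lemma null_set_cover (N : set (measurableTypeR R)) (eps : R) :
  mu N = 0%E -> 0 < eps ->
  exists a b : nat -> R, [/\ forall j, a j <= b j,
    N `<=` \bigcup_j `]a j, b j]%classic &
    (\sum_(j <oo) (b j - a j)%:E < eps%:E)%E].
Proof.
move=> N0 eps0.
have : (mu N < eps%:E)%E by rewrite N0 lte_fin.
rewrite /lebesgue_measure /lebesgue_stieltjes_measure /measure_extension /mu_ext.
move=> /ereal_inf_lt[_ [A [mA NA] <-] Aeps].
have /choice[ab abE] : forall j, exists p : R * R,
    p.1 <= p.2 /\ A j = `]p.1, p.2]%classic.
  move=> j; have /ocitvP[->|[p p12 ->]] := mA j.
    by exists (0, 0); rewrite set_itvoc0.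
  by exists p; rewrite ltW.
exists (fun j => (ab j).1), (fun j => (ab j).2); split.
- by move=> j; have [] := abE j.
- by move=> x /NA [j _ Aj]; exists j => //; have [_ <-] := abE j.
- apply: le_lt_trans Aeps; rewrite le_eqVlt; apply/orP; left; apply/eqP.
  apply: eq_eseriesr => j _; have [le_ab ->] := abE j.
  exact/esym/(@wlength_itv_bnd R idfun _ _ false false le_ab).
Qed.

Context {d : measure_display} {T : measurableType d}.
Variable P : probability T R.
Variable nu : {measure set (measurableTypeR R) -> \bar R}.
Hypothesis nu_moment : (\int[nu]_(x in `[1%R, +oo[) x%:E < +oo)%E.
Variable L : R -> T -> R.
Hypothesis L_sub : two_sided_subordinator P nu L.

(** Cover [N] by intervals of total length [eps]. The increments of [L] over them
have a sum of mean at most a constant times [eps], and this sum dominates the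
mass of [N]. Dominating by measurable functions avoids proving that the mass
of [N] depends measurably on [w]. *)
Lemma stieltjes_null_set (N : set (measurableTypeR R)) :
  measurable N -> mu N = 0%E -> {ae P, forall w, stieltjes (L ^~ w) N = 0%E}.
Proof.
move=> mN N0; have [C C0 incL] := two_sided_increment_mean L_sub nu_moment.
have dom (eps : R) : 0 < eps -> exists Z : T -> \bar R,
    [/\ measurable_fun setT Z, forall w, (0 <= Z w)%E,
      (\int[P]_w Z w <= ((C + 1) * eps)%:E)%E &
      {ae P, forall w, stieltjes (L ^~ w) N <= Z w}%E].
  move=> eps0; have [a [b [ab Nab len]]] := null_set_cover N0 eps0.
  pose e j : R := eps / (2 ^ j.+1)%:R.
  have e0 j : 0 < e j by rewrite divr_gt0// ltr0n expn_gt0.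
  have /choice[Y YP] := fun j => incL _ _ _ (ab j) (e0 j).
  exists (fun w => \sum_(j <oo) (Y j w)%:E)%E; split.
  - apply: ge0_emeasurable_sum => [j w _ _|j _].
      by rewrite lee_fin; have [] := YP j.
    by apply/measurable_EFinP; have [] := YP j.
  - by move=> w; apply: nneseries_ge0 => j _ _; rewrite lee_fin; have [] := YP j.
  - rewrite integral_nneseries//; last 2 first.
    + by move=> j; apply/measurable_EFinP; have [] := YP j.
    + by move=> j w _; rewrite lee_fin; have [] := YP j.
    apply: (@le_trans _ _ (\sum_(j <oo) (C%:E * (b j - a j)%:E + (e j)%:E))%E).
      apply: lee_nneseries => [j _ _|j _].
        by apply: integral_ge0 => w _; rewrite lee_fin; have [] := YP j.
      by rewrite -EFinM -EFinD; have [] := YP j.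
    have len0 j : (0 <= (b j - a j)%:E)%E by rewrite lee_fin subr_ge0.
    apply: le_trans (epsilon_trick _ _ (ltW eps0)) _.
      by move=> j; rewrite mule_ge0.
    rewrite nneseriesZl; last by move=> j _; exact: len0.
    rewrite mulrDl mul1r EFinD; apply: leeD => //.
    by rewrite EFinM; apply: lee_wpmul2l => //; exact: ltW.
  - have /ae_foralln := fun j => let: And4 _ _ _ h := YP j in h.
    apply: filterS => w Yw.
    apply: le_trans (measure_sigma_subadditive _ _ mN Nab) _.
      by move=> j; exact: measurable_itv.
    apply: lee_nneseries => [j _ _|j _]; first exact: measure_ge0.
    apply: le_trans (stieltjes_itv_le _ (ab j)) _.
    by rewrite lee_fin ge_max Yw andbT; have [] := YP j.
have eps0 k : (0 : R) < k.+1%:R^-1 by rewrite invr_gt0.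
have /choice[Z ZP] := fun k => dom _ (eps0 k).
pose Zi w := einfs (Z ^~ w) 0.
have mZi : measurable_fun setT Zi.
  by apply: measurable_fun_einfs => k; have [] := ZP k.
have Zi0 w : (0 <= Zi w)%E.
  by apply: le_ereal_inf_tmp => _ [k _ <-]; have [] := ZP k.
have ZiZ k w : (Zi w <= Z k w)%E by apply: ereal_inf_lbound; exists k.
have int0 : (\int[P]_w `|Zi w| = 0)%E.
  apply/eqP; rewrite eq_le integral_ge0// andbT.
  apply/lee_addgt0Pr => eps eps_gt0; rewrite add0e.
  have C1 : 0 < C + 1 by rewrite ltr_wpDl.
  have ec0 : 0 < eps / (C + 1) by exact: divr_gt0.
  near \oo => k.
  have [mZk Zk0 intZ _] := ZP k.
  apply: (@le_trans _ _ (\int[P]_w Z k w)%E).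
    apply: ge0_le_integral => //.
    - exact: measurableT_comp mZi.
    - by move=> w _; rewrite gee0_abs.
  apply: (le_trans intZ); rewrite lee_fin mulrC -ler_pdivlMr//.
  by apply: ltW; near: k; exact: (near_infty_natSinv_lt (PosNum ec0)).
have /(ae_eq_integral_abs P measurableT mZi) Zi_ae := int0.
have /ae_foralln S_le := fun k => let: And4 _ _ _ h := ZP k in h.
apply: filterS2 Zi_ae S_le => w /(_ I)/= Ziw Sw.
apply/eqP; rewrite eq_le measure_ge0 andbT -Ziw.
by apply: le_ereal_inf_tmp => _ [k _ <-].
Unshelve. all: by end_near. Qed.

(** Nonnegativity of [g] fails on a Lebesgue null set only, whose reflection is
almost surely not charged by the path, so [g] may be replaced by its positive
part. *)
Lemma moving_average_ge0 (g : R -> R) (t : R) :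
  mu.-integrable `[0%R, +oo[ (EFin \o g) ->
  {ae mu, forall s : R, 0 <= s -> 0 <= g s} ->
  {ae P, forall w, 0 <= moving_average g L t w}.
Proof.
move=> gi [Z [mZ Z0 gZ]].
pose N : set (measurableTypeR R) := (fun u : R => t - u) @^-1` Z.
have mT : measurable_fun setT (fun u : measurableTypeR R => (t - u : measurableTypeR R)).
  by apply: measurable_funB.
have mN : measurable N by rewrite -[N]setTI; exact: mT.
have N0 : mu N = 0%E by rewrite lebesgue_measure_reflect.
have mI : measurable (`]-oo, t]%classic : set (measurableTypeR R)).
  exact: measurable_itv.
have mg : measurable_fun (`]-oo, t]%classic : set (measurableTypeR R))
    (fun u : R => g (t - u)).
  have mg0 : measurable_fun (`[0%R, +oo[%classic : set (measurableTypeR R)) g.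
    by apply/measurable_EFinP; exact: (measurable_int mu gi).
  apply: (measurable_comp (F := (`[0%R, +oo[%classic : set (measurableTypeR R)))) => //.
  - move=> _ [u + <-]; rewrite /= !in_itv/= andbT subr_ge0; exact.
  - exact: measurable_funTS.
apply: filterS (stieltjes_null_set mN N0) => w Nw.
rewrite /moving_average.
have -> : \int[stieltjes (L ^~ w)]_(u in `]-oo, t]) g (t - u) =
    \int[stieltjes (L ^~ w)]_(u in `]-oo, t]) Num.max 0 (g (t - u)).
  rewrite /Rintegral; congr fine; apply: ae_eq_integral => //.
  - exact/measurable_EFinP.
  - by apply/measurable_EFinP; exact: measurable_maxr.
  exists N; split => // u /= /not_implyP[ut gu]; apply: gZ => /= gu0.
  apply: gu; rewrite max_r// gu0// subr_ge0.
  by move: ut; rewrite in_itv.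
by apply: Rintegral_ge0 => u _; rewrite le_max lexx.
Qed.

End NullSets.

Theorem theorem2p7 (R : realType) (d : measure_display) (T : measurableType d)
    (P : probability T R)
    (nu : {measure set (measurableTypeR R) -> \bar R}) (L : R -> T -> R)
    (phi : signed_measure R) (g : R -> R)
    (L_subordinator : two_sided_subordinator P nu L)
    (nu_neq0 : nu setT <> 0%E)
    (nu_moment : (\int[nu]_(x in `[1%R, +oo[) x%:E < +oo)%E)
    (phi_moment : (\int[sm_var phi]_(t in `[0%R, +oo[) (t ^+ 2)%:E < +oo)%E)
    (h_neq0 : forall z : R[i], 0 <= complex.Re z -> h_fun phi z <> 0)
    (g_phi : is_g_fun phi g)
    (phi_ge0 : forall B : set (measurableTypeR R), measurable B ->
       (0 <= sm_val phi (B `&` `]0%R, +oo[%classic))%E) :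
  [/\ exists t : R, {ae P, forall w, 0 <= moving_average g L t w},
      forall t : R, {ae P, forall w, 0 <= moving_average g L t w},
      {ae lebesgue_measure, forall t : R, 0 <= t -> 0 <= g t} &
      completely_monotone (fun x : R => complex.Re (1 / h_fun phi x%:C))].
Proof.
have g_ge0_ae := g_ge0 phi_ge0 h_neq0 g_phi.
have X_ge0 (t : R) : {ae P, forall w, 0 <= moving_average g L t w}.
  exact: (moving_average_ge0 nu_moment L_subordinator t g_phi.1 g_ge0_ae).
split => //; first by exists 0.
exact: inverse_h_completely_monotone.
Qed.
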